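(* Let $\Omega=\{(x_1,x_2,x_3)\in\mathbb{R}^3: x_1^2+x_2^2<1+x_3^2\}$ (the 1-sheeted hyperboloid), let $\delta(\mathbf{x})=\operatorname{dist}(\mathbf{x},\partial\Omega)$ for $\mathbf{x}\in\Omega$, and let $\mathcal{R}(\Omega)=\{(0,0,x_3):x_3\in\mathbb{R}\}$ be its ridge. For $\mathbf{x}\in\Omega\setminus\mathcal{R}(\Omega)$ let $\mathbf{y}=N(\mathbf{x})$ be the near point of $\mathbf{x}$ on $\partial\Omega$, let $p(\mathbf{x})$ be the ridge point of $\mathbf{x}$, let $w=|\mathbf{y}|=\delta(p(\mathbf{x}))$, and put $$\tilde\kappa(\mathbf{x})=-\frac{1}{w^3-\delta(\mathbf{x})}+\frac{1}{w+\delta(\mathbf{x})}.$$ Then for every $p\in(1,\infty)$ and every $f\in C_0^\infty(\Omega\setminus\mathcal{R}(\Omega))$, $$\int_\Omega|\nabla\delta\cdot\nabla f|^p\,d\mathbf{x}\ \ge\ \left(\frac{p-1}{p}\right)^p\int_\Omega\frac{|f|^p}{\delta^p}\,d\mathbf{x}-\left(\frac{p-1}{p}\right)^{p-1}\int_\Omega\tilde\kappa\,\frac{|f|^p}{\delta^{p-1}}\,d\mathbf{x}.$$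
   Context: The near point $N(\mathbf{x})$ of $\mathbf{x}\in\Omega\setminus\mathcal{R}(\Omega)$ is the unique $\mathbf{y}\in\partial\Omega$ with $|\mathbf{x}-\mathbf{y}|=\delta(\mathbf{x})$. Its ridge point is $p(\mathbf{x})=\mathbf{y}+\lambda[\mathbf{x}-\mathbf{y}]$, where $\lambda=\sup\{t\in(0,\infty): |t(\mathbf{x}-\mathbf{y})|=\delta(\mathbf{y}+t[\mathbf{x}-\mathbf{y}])\}$ (supremum over $t$ for which $\mathbf{y}$ is a near point of $\mathbf{y}+t[\mathbf{x}-\mathbf{y}]$), and the ridge is the set of all ridge points. If $\mathbf{y}=(\sqrt{s^2+1}\cos t,\sqrt{s^2+1}\sin t,s)$ then $w=\sqrt{2s^2+1}$. (The exponent $p$ is unrelated to the ridge-point map $p(\cdot)$.) *)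

(* Defs.v *)
From HB Require Import structures.
From mathcomp Require Import all_boot all_order all_algebra.
From mathcomp Require Import all_classical all_reals all_analysis.
Set Implicit Arguments.
Unset Strict Implicit.
Unset Printing Implicit Defensive.
Import Order.TTheory GRing.Theory Num.Theory.
Import numFieldNormedType.Exports.
Local Open Scope classical_set_scope.
Local Open Scope ring_scope.

(* Points of R^3 are triples ((x1, x2), x3).  The library norm on a product is
   the sup norm, hence the Euclidean norm [enorm] below; both norms induce the
   same topology, the product topology. *)
Notation space3 R := (R * R * R)%type.

Section Euclidean.
Context {R : realType}.
Implicit Types (u v x y : space3 R) (Om : set (space3 R)).

Definition basis_vec (i : 'I_3) : space3 R :=
  ((i == 0%N :> nat)%:R, (i == 1%N :> nat)%:R, (i == 2%N :> nat)%:R).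

Definition dot u v : R := u.1.1 * v.1.1 + u.1.2 * v.1.2 + u.2 * v.2.

Definition enorm u : R := Num.sqrt (dot u u).

Definition partial (i : 'I_3) (f : space3 R -> R) : space3 R -> R :=
  'D_(basis_vec i) f.

Definition gradient (f : space3 R -> R) x : space3 R :=
  (partial (@Ordinal 3 0 isT) f x, partial (@Ordinal 3 1 isT) f x,
   partial (@Ordinal 3 2 isT) f x).

(* [measurableTypeR R] is R with its Borel sigma-algebra. *)
Definition lebesgue3 :
    {measure set (measurableTypeR R * measurableTypeR R * measurableTypeR R)%type
       -> \bar R} :=
  ((@lebesgue_measure R \x @lebesgue_measure R) \x @lebesgue_measure R)%E.

Fixpoint Ck (k : nat) (f : space3 R -> R) : Prop :=
  match k with
  | 0 => continuous f
  | k'.+1 => continuous f /\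
      forall i : 'I_3, (forall x, derivable f x (basis_vec i)) /\
                       Ck k' (partial i f)
  end.

Definition smooth (f : space3 R -> R) : Prop := forall k, Ck k f.

(* Elements of C_0^oo(Om) are extended by zero to the whole space. *)
Definition test_function Om (f : space3 R -> R) : Prop :=
  [/\ smooth f, compact (closure [set x | f x != 0])
    & closure [set x | f x != 0] `<=` Om].

Definition boundary Om : set (space3 R) := closure Om `\` interior Om.

(* Defined on the whole space, including outside Om. *)
Definition bdist Om x : R := inf [set enorm (x - y) | y in boundary Om].

Definition is_near_point Om x y : Prop :=
  boundary Om y /\ enorm (x - y) = bdist Om x.

(* Defaults to 0 if x has no near point; arbitrary if it has several. *)
Definition near_point Om x : space3 R := xget 0 (is_near_point Om x).

Definition ridge_point Om x : space3 R :=
  let y := near_point Om x in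
  let lambda := sup [set t : R | 0 < t /\
    enorm (t *: (x - y)) = bdist Om (y + t *: (x - y))] in
  y + lambda *: (x - y).

End Euclidean.

Section Hyperboloid.
Context {R : realType}.

Definition hyperboloid : set (space3 R) :=
  [set x | x.1.1 ^+ 2 + x.1.2 ^+ 2 < 1 + x.2 ^+ 2].

Definition hyp_ridge : set (space3 R) := [set x | x.1.1 = 0 /\ x.1.2 = 0].

Definition delta (x : space3 R) : R := bdist hyperboloid x.

Definition kappa_tilde (x : space3 R) : R :=
  let w := enorm (near_point hyperboloid x) in
  - (w ^+ 3 - delta x)^-1 + (w + delta x)^-1.

End Hyperboloid.

(* Main.v *)
(* The inner normal of the boundary at [y] is [(-y1, -y2, y3) / |y|], so every
   point of the domain off the axis is
   [x = ((1 - t) y1, (1 - t) y2, (1 + t) y3)] with [0 < t < 1], and for another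
   boundary point [y + v]
     [|x - (y + v)|^2 = t^2 |y|^2 + (1 - t) (v1^2 + v2^2) + (1 + t) v3^2].
   Hence [y] is the only near point, the distance is [t |y|], and the ridge
   point [(0, 0, 2 y3)] is reached at [t = 1].
   Implicit differentiation of [r^2 / (1 - t)^2 - x3^2 / (1 + t)^2 = 1] shows
   that the distance [d] is C^2 off the axis, with
     [grad d = (-y1, -y2, y3) / w] and [lap d = 1 / (w^3 + d) - 1 / (w - d)].
   The compactly supported field [|f|^p d^(1-p) grad d] has zero integral of
   divergence; Young's inequality then gives the Hardy inequality with [lap d]
   in place of [kappa_tilde], and [lap d <= kappa_tilde] because [1 <= w]. *)
Require Import Defs.
From HB Require Import structures.
From mathcomp Require Import all_boot all_order all_algebra.
From mathcomp Require Import all_classical all_reals all_analysis.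
From mathcomp Require Import measurable_realfun ring lra.
Import Order.TTheory GRing.Theory Num.Theory.
Import numFieldNormedType.Exports.
Local Open Scope classical_set_scope.
Local Open Scope ring_scope.

Set Implicit Arguments.
Unset Strict Implicit.
Unset Printing Implicit Defensive.

(** * Near points and ridge points *)

(** The compact support of [f] avoids the boundary, where d^(1-p) is singular, and the axis, where
    the distance loses its smoothness. So every integrand extends by zero to a continuous function
    with compact support on the whole space, and the zero integral of the divergence is Fubini plus
    the fundamental theorem of calculus on lines parallel to the axes. For p < 2 the factor |f|^p is
    in general no better than C^1, so the argument asks only for continuous first partial
    derivatives of the field. The implicit differentiation is done by hand: a divided difference of
    the defining equation is bounded below, which gives first continuity of the ray parameter and
    then its derivative as the limit of an explicit quotient. The constants come from an
    optimization. If the divergence is multiplied by B, Young's inequality leaves (p-1) (B -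
    B^(p/(p-1))) in front of |f|^p / d^p; this is largest at B = c^(p-1) with c = (p-1)/p, and its
    value there is c^p. *)

Section Geometry.
Context {R : realType}.
Implicit Types (t : R) (x y z v : space3 R).

Definition ray t y : space3 R :=
  ((1 - t) * y.1.1, (1 - t) * y.1.2, (1 + t) * y.2).

Definition on_hyperboloid y := y.1.1 ^+ 2 + y.1.2 ^+ 2 = 1 + y.2 ^+ 2.

Lemma space3_eq x y : x.1.1 = y.1.1 -> x.1.2 = y.1.2 -> x.2 = y.2 -> x = y.
Proof. by case: x y => [[a b] c] [[a' b'] c'] /= -> -> ->. Qed.

Lemma continuous_x1 : continuous (fun x : space3 R => x.1.1).
Proof. by move=> x; apply: continuous_comp; exact: cvg_fst. Qed.

Lemma continuous_x2 : continuous (fun x : space3 R => x.1.2).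
Proof. by move=> x; apply: continuous_comp; [exact: cvg_fst|exact: cvg_snd]. Qed.

Lemma continuous_x3 : continuous (fun x : space3 R => x.2).
Proof. by move=> x; exact: cvg_snd. Qed.

Lemma continuous_hyp : continuous
  (fun x : space3 R => x.1.1 * x.1.1 + x.1.2 * x.1.2 - x.2 * x.2).
Proof.
move=> x; apply: cvgB; first apply: cvgD.
- by apply: cvgM; exact: continuous_x1.
- by apply: cvgM; exact: continuous_x2.
- by apply: cvgM; exact: continuous_x3.
Qed.

Lemma open_hyperboloid : open (@hyperboloid R).
Proof.
have -> : @hyperboloid R = (fun x : space3 R =>
    x.1.1 * x.1.1 + x.1.2 * x.1.2 - x.2 * x.2) @^-1` [set u | u < 1].
  by apply/seteqP; split => x; rewrite /hyperboloid /=; lra.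
by apply: open_comp => [x _|]; [exact: continuous_hyp|exact: open_lt].
Qed.

Lemma closed_hyp_ridge : closed (@hyp_ridge R).
Proof.
have -> : @hyp_ridge R = (fun x => x.1.1) @^-1` [set 0] `&`
  (fun x => x.1.2) @^-1` [set 0] by [].
apply: closedI; apply: closed_comp => [x _|]; try exact: closed_eq.
- exact: continuous_x1.
- exact: continuous_x2.
Qed.

Lemma open_hyp_regular : open (@hyperboloid R `\` hyp_ridge).
Proof.
by apply: openI; [exact: open_hyperboloid|exact: closed_openC closed_hyp_ridge].
Qed.

Lemma ray_continuous y : continuous (fun t => ray t y).
Proof.
move=> t.
have cm (a : R) : (1 - u) * a @[u --> t] --> (1 - t) * a.
  by apply: cvgM; [apply: cvgB; [exact: cvg_cst|exact: cvg_id]|exact: cvg_cst].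
have cp (a : R) : (1 + u) * a @[u --> t] --> (1 + t) * a.
  by apply: cvgM; [apply: cvgD; [exact: cvg_cst|exact: cvg_id]|exact: cvg_cst].
exact: (cvg_pair (cvg_pair (cm y.1.1) (cm y.1.2)) (cp y.2)).
Qed.

Lemma boundary_hyperboloid : boundary (@hyperboloid R) = [set y | on_hyperboloid y].
Proof.
rewrite /boundary.
have -> : interior (@hyperboloid R) = hyperboloid.
  exact/interior_id/open_hyperboloid.
apply/seteqP; split => y.
  move=> [cy ny]; rewrite /on_hyperboloid /=.
  have hy : 1 + y.2 ^+ 2 <= y.1.1 ^+ 2 + y.1.2 ^+ 2 by rewrite leNgt; exact/negP.
  apply/eqP; rewrite eq_le hy andbT.
  suff : [set x : space3 R | x.1.1 * x.1.1 + x.1.2 * x.1.2 - x.2 * x.2 <= 1] y.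
    by rewrite /=; lra.
  have cl : closed [set x : space3 R | x.1.1 * x.1.1 + x.1.2 * x.1.2 - x.2 * x.2 <= 1].
    have -> : [set x : space3 R | x.1.1 * x.1.1 + x.1.2 * x.1.2 - x.2 * x.2 <= 1]
      = (fun x : space3 R => x.1.1 * x.1.1 + x.1.2 * x.1.2 - x.2 * x.2) @^-1`
        [set u | u <= 1] by [].
    by apply: closed_comp => [x _|]; [exact: continuous_hyp|exact: closed_le].
  rewrite ((closure_id _).1 cl); apply: closureS cy => x.
  by rewrite /hyperboloid /=; lra.
rewrite /on_hyperboloid /= => by_; split; last by rewrite /hyperboloid /= by_ ltxx.
move=> B nB.
(* A surface point is a limit of domain points along its own inner normal. *)
near (0 : R)^'+ => t.
have Bt : B (ray t y).
  near: t; apply: cvg_at_right_filter nB.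
  have sh0 : ray 0 y = y.
    by apply: space3_eq; rewrite /ray /= ?subr0 ?addr0 mul1r.
  suff : ray u y @[u --> 0] --> ray 0 y by rewrite sh0.
  exact: ray_continuous.
have t0 : 0 < t by near: t; exact: nbhs_right_gt.
have t1 : t < 1 by near: t; exact: nbhs_right_lt.
exists (ray t y); split => //.
rewrite /hyperboloid /ray /=.
by have := sqr_ge0 y.2; nra.
Unshelve. all: by end_near.
Qed.

Lemma dot_ray t y z : on_hyperboloid y -> on_hyperboloid z ->
  dot (ray t y - z) (ray t y - z) = t ^+ 2 * dot y y
   + (1 - t) * ((z.1.1 - y.1.1) ^+ 2 + (z.1.2 - y.1.2) ^+ 2)
   + (1 + t) * (z.2 - y.2) ^+ 2.
Proof.
case: y z => [[a b] c] [[a' b'] c']; rewrite /on_hyperboloid /dot /ray /= => h h'.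
(* With the correction [t * (q' - q)] the expansion is a polynomial identity in free variables; the
   surface equations enter only as [q = q' = 0]. *)
set q := a ^+ 2 + b ^+ 2 - (1 + c ^+ 2); set q' := a' ^+ 2 + b' ^+ 2 - (1 + c' ^+ 2).
have [q0 q'0] : q = 0 /\ q' = 0 by rewrite /q /q' h h' !subrr.
transitivity (t ^+ 2 * (a * a + b * b + c * c) +
  (1 - t) * ((a' - a) ^+ 2 + (b' - b) ^+ 2) + (1 + t) * (c' - c) ^+ 2
  + t * (q' - q)); first by rewrite /q /q'; ring.
by rewrite q0 q'0 subrr mulr0 addr0.
Qed.

Lemma dot_ge0 x : 0 <= dot x x.
Proof. by rewrite /dot -!expr2 !addr_ge0 ?sqr_ge0. Qed.

Lemma enorm_ge0 x : 0 <= enorm x. Proof. exact: sqrtr_ge0. Qed.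

Lemma enorm_sqr x : enorm x ^+ 2 = dot x x.
Proof. by rewrite sqr_sqrtr ?dot_ge0. Qed.

Lemma on_hyperboloid_enorm y : on_hyperboloid y -> enorm y ^+ 2 = 1 + 2 * y.2 ^+ 2.
Proof. by rewrite enorm_sqr /on_hyperboloid /dot => h; nra. Qed.

Lemma on_hyperboloid_enorm_ge1 y : on_hyperboloid y -> 1 <= enorm y.
Proof.
move=> /on_hyperboloid_enorm h; have := enorm_ge0 y; have := sqr_ge0 y.2; nra.
Qed.

Lemma enorm_ray_self t y : 0 <= t -> on_hyperboloid y ->
  enorm (ray t y - y) = t * enorm y.
Proof.
move=> t0 by_; rewrite /enorm dot_ray// !subrr expr0n /= addr0 !mulr0 !addr0.
by rewrite sqrtrM ?sqr_ge0// sqrtr_sqr ger0_norm.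
Qed.

Lemma inf_min (S : set R) m : S m -> lbound S m -> inf S = m.
Proof.
move=> Sm lb; apply/eqP; rewrite eq_le; apply/andP; split.
  by apply: ge_inf => //; exists m.
by apply: lb_le_inf => //; exists m.
Qed.

(** In [dot_ray] the weights [1 - t] and [1 + t] are nonnegative, so [z = y] is a minimizer. The
    endpoint [t = 1] is included in order to evaluate the distance on the axis. *)
Lemma delta_ray t y : 0 <= t <= 1 -> on_hyperboloid y -> delta (ray t y) = t * enorm y.
Proof.
move=> /andP[t0 t1] by_; apply: inf_min.
  by exists y; [rewrite boundary_hyperboloid|rewrite enorm_ray_self].
move=> u [z + <-]; rewrite boundary_hyperboloid /= => bz.
rewrite -enorm_ray_self//; apply: ler_wsqrtr; rewrite !dot_ray//.
rewrite !subrr expr0n /= addr0 !mulr0 !addr0 -addrA lerDl.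
by apply: addr_ge0; apply: mulr_ge0; rewrite ?subr_ge0 ?addr_ge0 ?sqr_ge0.
Qed.

(** For [t < 1] both weights in [dot_ray] are positive, so equality of distances makes every
    coordinate difference vanish. At [t = 1] the horizontal weight is 0 and the whole circle at the
    height of [y] would be near. *)
Lemma near_rayP t y z : 0 <= t < 1 -> on_hyperboloid y ->
  is_near_point hyperboloid (ray t y) z <-> z = y.
Proof.
move=> /andP[t0 t1] by_; rewrite /is_near_point boundary_hyperboloid.
rewrite -/(delta _) delta_ray ?t0 ?(ltW t1)//; split => [[/= bz E]|->]; last first.
  by split => //; rewrite enorm_ray_self.
have := congr1 (fun u => u ^+ 2) E; rewrite /= exprMn !enorm_sqr dot_ray//.
move=> {}E.
have a2 := sqr_ge0 (z.1.1 - y.1.1); have b2 := sqr_ge0 (z.1.2 - y.1.2).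
have c2 := sqr_ge0 (z.2 - y.2).
have [a0 b0 c0] : [/\ (z.1.1 - y.1.1) ^+ 2 = 0, (z.1.2 - y.1.2) ^+ 2 = 0
    & (z.2 - y.2) ^+ 2 = 0] by split; nra.
by apply: space3_eq; apply/eqP; rewrite -subr_eq0 -sqrf_eq0; apply/eqP.
Qed.

Lemma near_point_ray t y : 0 <= t < 1 -> on_hyperboloid y ->
  near_point hyperboloid (ray t y) = y.
Proof.
move=> t01 by_; rewrite /near_point; case: xgetP => [z _|].
  by move=> /(near_rayP _ t01 by_).
by move=> /(_ y) []; apply/near_rayP.
Qed.

Lemma ray_ex x : (hyperboloid `\` hyp_ridge) x ->
  exists t y, [/\ 0 < t < 1, on_hyperboloid y & x = ray t y].
Proof.
move=> [hx /= nr].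
have r0 : 0 < x.1.1 ^+ 2 + x.1.2 ^+ 2.
  rewrite lt_neqAle addr_ge0 ?sqr_ge0// andbT eq_sym.
  apply/eqP => /eqP; rewrite paddr_eq0 ?sqr_ge0// !sqrf_eq0.
  by move=> /andP[/eqP ? /eqP ?]; apply: nr.
(* The equation for the ray parameter with denominators cleared. It is negative at 0 because [x] is
   in the domain and positive at 1 because [x] is off the axis. *)
pose P t := (x.1.1 ^+ 2 + x.1.2 ^+ 2) * ((1 + t) * (1 + t))
  - x.2 ^+ 2 * ((1 - t) * (1 - t))
  - ((1 - t) * (1 - t)) * ((1 + t) * (1 + t)).
have cp : continuous (fun t => 1 + t : R).
  by move=> u; apply: cvgD; [exact: cvg_cst|exact: cvg_id].
have cm : continuous (fun t => 1 - t : R).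
  by move=> u; apply: cvgB; [exact: cvg_cst|exact: cvg_id].
have cP : continuous P.
  move=> t; apply: cvgB; first apply: cvgB.
  - by apply: cvgM; [exact: cvg_cst|apply: cvgM; exact: cp].
  - by apply: cvgM; [exact: cvg_cst|apply: cvgM; exact: cm].
  - by apply: cvgM; apply: cvgM; [exact: cm|exact: cm|exact: cp|exact: cp].
have P0 : P 0 < 0 by move: hx; rewrite /P /hyperboloid /=; lra.
have P1 : 0 < P 1 by rewrite /P; lra.
have [t] := @IVT R P 0 1 0 ler01 (continuous_subspaceT cP)
  ltac:(by rewrite ge_min le_max (ltW P0) (ltW P1) orbT).
rewrite in_itv /= => /andP[t0 t1] Pt.
have t0' : 0 < t.
  rewrite lt_neqAle t0 andbT; apply/negP => /eqP E.
  by move: P0; rewrite [in P 0]E Pt ltxx.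
have t1' : t < 1.
  rewrite lt_neqAle t1 andbT; apply/negP => /eqP E.
  by move: P1; rewrite -[in P 1]E Pt ltxx.
have m0 : 1 - t != 0 by lra.
have p0 : 1 + t != 0 by lra.
exists t, (x.1.1 / (1 - t), x.1.2 / (1 - t), x.2 / (1 + t)); split.
- by rewrite t0' t1'.
- rewrite /on_hyperboloid /=; apply/eqP; rewrite -subr_eq0; apply/eqP.
  transitivity (P t / ((1 - t) ^+ 2 * (1 + t) ^+ 2)); last by rewrite Pt mul0r.
  by rewrite /P; field; rewrite m0 p0.
- by apply: space3_eq; rewrite /ray /= mulrC divfK.
Qed.

Lemma near_point_unique x : (hyperboloid `\` hyp_ridge) x ->
  exists! y : space3 R, is_near_point hyperboloid x y.
Proof.
move=> /ray_ex[t [y [/andP[t0 t1] by_ ->]]]; exists y; split.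
  by apply/near_rayP => //; rewrite t1 ltW.
by move=> z /near_rayP ->//; rewrite t1 ltW.
Qed.

Lemma hyp_regular_ray t y : 0 < t < 1 -> on_hyperboloid y ->
  (hyperboloid `\` hyp_ridge) (ray t y).
Proof.
move=> /andP[t0 t1]; case: y => [[a b] c].
rewrite /on_hyperboloid /hyperboloid /hyp_ridge /ray /= => h; split.
  by have := sqr_ge0 c; nra.
move=> [/eqP + /eqP]; rewrite !mulf_eq0 !subr_eq0 (gt_eqF t1) /=.
by move=> /eqP a0 /eqP b0; move: h (sqr_ge0 c); rewrite a0 b0; nra.
Qed.

Lemma ridge_point_ray t y : 0 < t < 1 -> on_hyperboloid y ->
  ridge_point hyperboloid (ray t y) = (0, 0, 2 * y.2).
Proof.
move=> /andP[t0 t1] by_; rewrite /ridge_point near_point_ray ?t1 ?ltW//=.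
(* The factor [u] rescales the ray parameter to [u * t], so the last parameter 1 corresponds to
   [u = t^-1]. *)
have lineE u : y + u *: (ray t y - y) = ray (u * t) y.
  case: y by_ => [[a b] c] _.
  apply: space3_eq.
  - by change (a + u * ((1 - t) * a - a) = (1 - u * t) * a); ring.
  - by change (b + u * ((1 - t) * b - b) = (1 - u * t) * b); ring.
  - by change (c + u * ((1 + t) * c - c) = (1 + u * t) * c); ring.
have lineE' u : u *: (ray t y - y) = ray (u * t) y - y.
  by rewrite -lineE addrAC subrr add0r.
suff -> : sup [set u : R | 0 < u /\ enorm (u *: (ray t y - y)) =
    bdist hyperboloid (y + u *: (ray t y - y))] = t^-1.
  rewrite lineE mulVf ?gt_eqF// /ray subrr !mul0r; congr (_, _).
set S := [set u | _].
have St : S t^-1.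
  split; first by rewrite invr_gt0.
  rewrite lineE lineE' mulVf ?gt_eqF// -/(delta _) delta_ray ?ler01 ?lexx//.
  by rewrite enorm_ray_self.
have ub : ubound S t^-1.
  move=> u [u0]; rewrite lineE lineE' => E.
  rewrite leNgt; apply/negP => tu.
  have ut : 1 < u * t by rewrite -ltr_pdivrMr// div1r.
  (* Beyond the axis the mirror image of [y] is closer than [y]. *)
  pose y' : space3 R := (- y.1.1, - y.1.2, y.2).
  have by' : on_hyperboloid y' by move: by_; rewrite /on_hyperboloid /y' /= !sqrrN.
  have : bdist hyperboloid (ray (u * t) y) <= enorm (ray (u * t) y - y').
    apply: ge_inf; first by exists 0 => _ [z _ <-]; exact: enorm_ge0.
    by exists y' => //; rewrite boundary_hyperboloid.
  rewrite -E; apply/negP; rewrite -ltNge /enorm ltr_sqrt; last first.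
    rewrite dot_ray// !subrr expr0n /= addr0 !mulr0 !addr0.
    have := on_hyperboloid_enorm_ge1 by_; rewrite -enorm_sqr => w1.
    by apply: mulr_gt0; rewrite exprn_gt0//; lra.
  (* [y] and [y'] have the same height, so the squared distances differ only by the horizontal term,
     whose weight [1 - u * t] is now negative. *)
  rewrite !dot_ray// ltrD2r// ltrD2l !subrr expr0n /= addr0 mulr0.
  rewrite nmulr_rlt0 ?subr_lt0//.
  by move: by_; rewrite /on_hyperboloid => h; have := sqr_ge0 y.2; nra.
apply/eqP; rewrite eq_le; apply/andP; split.
  by apply: ge_sup => //; exists t^-1.
by apply: ub_le_sup => //; exists t^-1.
Qed.

Lemma ridge_point_image :
  ridge_point hyperboloid @` (hyperboloid `\` hyp_ridge) = @hyp_ridge R.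
Proof.
apply/seteqP; split => x.
  move=> [_ /ray_ex[t [y [t01 by_ ->]]] <-].
  by rewrite ridge_point_ray.
(* The ridge point sits at twice the height of the near point, hence the half. The parameter [2^-1]
   below is an arbitrary choice in (0, 1). *)
move=> [x1 x2]; pose s := x.2 / 2.
pose y : space3 R := (Num.sqrt (1 + s ^+ 2), 0, s).
have by_ : on_hyperboloid y.
  by rewrite /on_hyperboloid /= sqr_sqrtr ?addr_ge0 ?sqr_ge0// expr0n addr0.
have t01 : 0 < (2^-1 : R) < 1 by lra.
exists (ray 2^-1 y); first exact: hyp_regular_ray.
by rewrite ridge_point_ray//; apply: space3_eq => //=; rewrite /s; field.
Qed.

Lemma delta_ridge_point x : (hyperboloid `\` hyp_ridge) x ->
  enorm (near_point hyperboloid x) = delta (ridge_point hyperboloid x).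
Proof.
move=> /ray_ex[t [y [t01 by_ ->]]]; rewrite ridge_point_ray//.
have /andP[t0 t1] := t01; rewrite near_point_ray ?t1 ?ltW//.
have -> : (0, 0, 2 * y.2) = ray 1 y :> space3 R.
  by apply: space3_eq; rewrite /ray /= ?subrr ?mul0r.
by rewrite delta_ray ?lexx ?ler01// mul1r.
Qed.

End Geometry.

(** * Integrals of partial derivatives with compact support *)

Section ProductIntegrals.
Context d1 d2 (T1 : measurableType d1) (T2 : measurableType d2) (R : realType).

Lemma integrable_bounded_support d (T : measurableType d)
    (m : {measure set T -> \bar R}) (A : set T) (h : T -> R) (C : R) :
  measurable A -> (m A < +oo)%E -> measurable_fun setT h ->
  (forall u : T, `|h u| <= C) -> (forall u : T, ~ A u -> h u = 0) ->
  m.-integrable setT (EFin \o h).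
Proof.
move=> mA Aoo mh hC h0.
have -> : EFin \o h = (EFin \o h) \_ A.
  apply/funext => x; rewrite patchE; case: ifPn => // /negP xA /=.
  by rewrite h0// => Ax; apply: xA; rewrite inE.
apply/(integrable_mkcond _ mA); apply: measurable_bounded_integrable => //.
  exact: measurable_funTS.
by exists C; split; [exact: num_real|move=> M CM x _; exact: le_trans (hC x) (ltW CM)].
Qed.

Variables (m1 : {sigma_finite_measure set T1 -> \bar R})
  (m2 : {sigma_finite_measure set T2 -> \bar R}).

Lemma product_measure_rect_lty A1 A2 : measurable A1 -> measurable A2 ->
  (m1 A1 < +oo)%E -> (m2 A2 < +oo)%E -> ((m1 \x m2)%E (A1 `*` A2) < +oo)%E.
Proof.
move=> mA1 mA2 f1 f2; rewrite (product_measure1E m1 m2 mA1 mA2).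
by rewrite lte_mul_pinfty// ge0_fin_numE.
Qed.

Lemma integrable_rect_support (f : T1 * T2 -> R) A1 A2 C : measurable A1 -> measurable A2 ->
  (m1 A1 < +oo)%E -> (m2 A2 < +oo)%E -> measurable_fun setT f ->
  (forall u : T1 * T2, `|f u| <= C) ->
  (forall u : T1 * T2, ~ (A1 `*` A2) u -> f u = 0) ->
  (m1 \x m2)%E.-integrable setT (EFin \o f).
Proof.
move=> mA1 mA2 f1 f2 mf fC f0.
apply: (integrable_bounded_support (measurableX mA1 mA2) _ mf fC f0).
exact: product_measure_rect_lty.
Qed.

(** Fubini in both orders, here and in [integral_product_eq0r], allows the differentiated coordinate
    to be integrated first whichever it is. *)
Lemma integral_product_eq0l (f : T1 * T2 -> R) : (m1 \x m2)%E.-integrable setT (EFin \o f) ->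
  (forall a, \int[m2]_b (f (a, b))%:E = 0)%E -> (\int[m1 \x m2]_u (f u)%:E = 0)%E.
Proof.
move=> intf h; transitivity (\int[m1]_a fubini_F m2 (EFin \o f) a)%E.
  by rewrite (integral12_prod_meas1 intf).
by apply: integral0_eq => a _; exact: h.
Qed.

Lemma integral_product_eq0r (f : T1 * T2 -> R) : (m1 \x m2)%E.-integrable setT (EFin \o f) ->
  (forall b, \int[m1]_a (f (a, b))%:E = 0)%E -> (\int[m1 \x m2]_u (f u)%:E = 0)%E.
Proof.
move=> intf h; transitivity (\int[m2]_b fubini_G m1 (EFin \o f) b)%E.
  by rewrite (integral21_prod_meas1 intf).
by apply: integral0_eq => b _; exact: h.
Qed.

Lemma measurable_slice (f : T1 * T2 -> R) b :
  measurable_fun [set: (T1 * T2)%type] f ->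
  measurable_fun [set: T1] (fun a : T1 => f (a, b)).
Proof. exact: measurable_fun_pair1. Qed.

End ProductIntegrals.

(** * Integrals over R^3 of continuous functions with compact support *)

Section CompactSupportIntegrals.
Context {R : realType}.
Notation mR := (measurableTypeR R).
Notation mu := (@lebesgue_measure R).
Implicit Types (x v : space3 R) (g F : space3 R -> R) (K : set (space3 R)).

(** Continuity refers to the product topology, measurability to the product of the Borel
    sigma-algebras. They are linked by writing an open set as a countable union of boxes with
    rational centres and radii 1/(n+1). *)
Lemma continuous_measurable3 g : continuous g ->
  measurable_fun [set: (mR * mR * mR)%type] (g : mR * mR * mR -> R).
Proof.
move=> cg; apply: (measurability _ (RGenOpens.measurableE R)).
move=> _ [_ [a [b ->] <-]]; rewrite setTI.
pose U : set (space3 R) := g @^-1` `]a, b[%classic.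
have oU : open U by move/continuousP: cg; apply; exact: interval_open.
pose bx (q1 q2 q3 : rat) (n : nat) : set (mR * mR * mR)%type :=
  (ball (ratr q1 : R) n.+1%:R^-1 `*` ball (ratr q2 : R) n.+1%:R^-1)
  `*` ball (ratr q3 : R) n.+1%:R^-1.
rewrite [X in measurable X](_ : _ = \bigcup_q1 \bigcup_q2 \bigcup_q3 \bigcup_n
    (if `[< bx q1 q2 q3 n `<=` U >] then bx q1 q2 q3 n else set0)).
  do 3 (apply: bigcupT_measurable_rat => ?); apply: bigcupT_measurable => n.
  case: asboolP => _; last exact: measurable0.
  by apply: measurableX; first apply: measurableX; apply: open_measurable; exact: ball_open.
apply/seteqP; split; last first.
  move=> x [q1 _ [q2 _ [q3 _ [n _]]]]; case: asboolP => //; exact.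
move=> x Ux; have : nbhs (x : space3 R) U by exact: open_nbhs_nbhs.
move=> /nbhs_ballP[e /= e0 eU].
(* A radius below [e / 2] puts any two points of one box within [e] of each other, so a box
   containing [x] stays in [U]. *)
have [n en] := @ltr_add_invr R 0 (e / 2) (divr_gt0 e0 (ltr0Sn _ _)).
rewrite add0r in en.
have n0 : 0 < n.+1%:R^-1 :> R by rewrite invr_gt0.
have ex (u : R) : exists q : rat, ball (ratr q : R) n.+1%:R^-1 u.
  have /rat_in_itvoo[q] : u - n.+1%:R^-1 < u + n.+1%:R^-1.
    by rewrite ltrBlDr -addrA ltrDl addr_gt0.
  rewrite in_itv /= => /andP[h1 h2]; exists q.
  rewrite /ball /= ltr_norml; apply/andP; split.
    by rewrite ltrBrDr addrC.
  by rewrite ltrBlDl.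
have [q1 h1] := ex x.1.1; have [q2 h2] := ex x.1.2; have [q3 h3] := ex x.2.
exists q1 => //; exists q2 => //; exists q3 => //; exists n => //.
case: asboolP => // -[] z [[z1 z2] z3]; apply: eU.
have tr (q u u' : R) : ball q n.+1%:R^-1 u -> ball q n.+1%:R^-1 u' -> ball u e u'.
  have ne := le_ball (ltW en); move=> /ne h /ne; exact: ball_splitr h.
by split; [split; [exact: tr h1 z1|exact: tr h2 z2]|exact: tr h3 z3].
Qed.

Definition cube (M : R) : set (space3 R) :=
  [set x | [/\ `|x.1.1| <= M, `|x.1.2| <= M & `|x.2| <= M]].

Lemma compact_sub_cube K : compact K -> exists2 M, 0 < M & K `<=` cube M.
Proof.
move=> /compact_bounded[M0 [_ KM]]; exists (`|M0| + 1); first by rewrite ltr_wpDl.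
move=> x Kx; have /= := KM (`|M0| + 1) _ x Kx.
rewrite (le_lt_trans (ler_norm _)) ?ltrDl// => /(_ isT).
by rewrite !prod_normE /= !ge_max => /andP[/andP[? ?] ?].
Qed.

Lemma compact_support_bounded K g : compact K -> continuous g ->
  (forall x, ~ K x -> g x = 0) -> exists C, forall x, `|g x| <= C.
Proof.
move=> cK cg g0.
have : compact (g @` K) by apply: continuous_compact => //; exact: continuous_subspaceT.
move=> /compact_bounded[M [_ hM]]; exists (`|M| + 1) => x.
have [Kx|nKx] := pselect (K x); last by rewrite g0// normr0 addr_ge0.
by apply: (hM (`|M| + 1)); [rewrite (le_lt_trans (ler_norm _)) ?ltrDl|exists x].
Qed.

Lemma lebesgue_itv_lty (M : R) : (mu [set` `[- M, M]%R] < +oo)%E.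
Proof. by rewrite lebesgue_measure_itv /=; case: ifP => // _; rewrite -EFinB ltry. Qed.



(** Fubini for the product of the planar measure with the third factor requires this; the squares of
    integer half-side exhaust the plane. *)
Lemma lebesgue2_sigma_finite : sigma_finite setT (mu \x mu)%E.
Proof.
pose I (n : nat) : set mR := [set` `[- n%:R, n%:R]%R].
have mI n : measurable (I n) by exact: measurable_itv.
exists (fun n => I n `*` I n); last first.
  move=> n; split; first exact: measurableX.
  exact: (@product_measure_rect_lty _ _ mR mR R mu mu (I n) (I n) (mI n) (mI n)
    (lebesgue_itv_lty _) (lebesgue_itv_lty _)).
apply/seteqP; split => // -[a b] _.
have I_ (u : R) n : (Num.bound `|u| <= n)%N -> I n u.
  move=> un; rewrite /I /= in_itv /= -ler_norml ltW//.
  by apply: (lt_le_trans (archi_boundP (normr_ge0 u))); rewrite ler_nat.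
by exists (maxn (Num.bound `|a|) (Num.bound `|b|)) => //; split; apply: I_;
  rewrite /= ?leq_maxl ?leq_maxr.
Qed.

Let mR2 := (mR * mR)%type : measurableType _.
(* The sigma-finite structure is given explicitly since canonical structure
   inference does not find it for this product measure. *)
Definition lebesgue2 : {sigma_finite_measure set mR2 -> \bar R} :=
  HB.pack_for {sigma_finite_measure set mR2 -> \bar R}
    (lebesgue_integral_fubini.product_measure1 mu mu)
    (Measure_isSigmaFinite.Build _ _ _ (lebesgue_integral_fubini.product_measure1 mu mu)
       lebesgue2_sigma_finite).

Section Cube.
Variables (M C : R) (g : space3 R -> R).
Hypotheses (cg : continuous g) (gC : forall u, `|g u| <= C).
Hypothesis (g0 : forall u, ~ cube M u -> g u = 0).
Let I : set mR := [set` `[- M, M]%R].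

Lemma measurable_side : measurable I.
Proof. exact: measurable_itv. Qed.

Lemma cube_vanish (u : mR2 * mR) : ~ ((I `*` I) `*` I) u -> g u = 0.
Proof.
move=> nu; apply: g0 => -[h1 h2 h3]; apply: nu.
by split; [split|]; rewrite /I /= in_itv /= -ler_norml.
Qed.

Lemma measurable_square : measurable (I `*` I : set mR2).
Proof. by apply: measurableX; exact: measurable_side. Qed.

Lemma square_lty : (lebesgue2 (I `*` I) < +oo)%E.
Proof.
exact: (@product_measure_rect_lty _ _ mR mR R mu mu I I measurable_side measurable_side
  (lebesgue_itv_lty M) (lebesgue_itv_lty M)).
Qed.

Lemma integrable_cube_prod :
  (lebesgue_integral_fubini.product_measure1 lebesgue2 mu).-integrable setT
    (EFin \o (g : mR2 * mR -> R)).
Proof.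
exact: (@integrable_rect_support _ _ mR2 mR R lebesgue2 mu (g : mR2 * mR -> R)
  (I `*` I) I C measurable_square measurable_side square_lty
  (lebesgue_itv_lty M) (continuous_measurable3 cg) gC cube_vanish).
Qed.

Lemma integrable_cube : (@lebesgue3 R).-integrable setT (EFin \o g).
Proof. exact: integrable_cube_prod. Qed.

Lemma integrable_cube_slice c :
  (lebesgue_integral_fubini.product_measure1 mu mu).-integrable setT
    (EFin \o (fun u : mR * mR => g (u, c))).
Proof.
apply: (@integrable_rect_support _ _ mR mR R mu mu (fun u => g (u, c)) I I C
  measurable_side measurable_side (lebesgue_itv_lty M) (lebesgue_itv_lty M)).
- exact: (@measurable_slice _ _ mR2 mR R g c (continuous_measurable3 cg)).
- by move=> u; exact: gC.
- by move=> u nu; apply: cube_vanish => -[].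
Qed.

(** Points are nested as [((x1, x2), x3)]: one use of Fubini isolates [x3], whereas [x2] and [x1]
    take a second one on the slice at fixed [x3], which is why [integrable_cube_slice] is proved. *)
Lemma lebesgue3_eq0_x3 :
  (forall a b : R, \int[mu]_c (g (a, b, c))%:E = 0)%E ->
  (\int[@lebesgue3 R]_x (g x)%:E = 0)%E.
Proof.
move=> h; apply: (@integral_product_eq0l _ _ mR2 mR R lebesgue2 mu g integrable_cube_prod).
by move=> -[a b]; exact: h.
Qed.

Lemma lebesgue3_eq0_x2 :
  (forall a c : R, \int[mu]_b (g (a, b, c))%:E = 0)%E ->
  (\int[@lebesgue3 R]_x (g x)%:E = 0)%E.
Proof.
move=> h; apply: (@integral_product_eq0r _ _ mR2 mR R lebesgue2 mu g integrable_cube_prod).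
move=> c; apply: (@integral_product_eq0l _ _ mR mR R mu mu _ (integrable_cube_slice c)).
by move=> a; exact: h.
Qed.

Lemma lebesgue3_eq0_x1 :
  (forall b c : R, \int[mu]_a (g (a, b, c))%:E = 0)%E ->
  (\int[@lebesgue3 R]_x (g x)%:E = 0)%E.
Proof.
move=> h; apply: (@integral_product_eq0r _ _ mR2 mR R lebesgue2 mu g integrable_cube_prod).
move=> c; apply: (@integral_product_eq0r _ _ mR mR R mu mu _ (integrable_cube_slice c)).
by move=> b; exact: h.
Qed.

End Cube.

Lemma integral_derive_eq0 (G f : R -> R) (M : R) : 0 < M -> continuous f ->
  (forall t : R, is_derive t 1 G (f t)) ->
  (forall t : R, M < `|t| -> G t = 0 /\ f t = 0) ->
  (\int[mu]_x (f x)%:E = 0)%E.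
Proof.
(* [G] is known to vanish only where [M < |t|], so the end points must lie strictly beyond [M]. *)
move=> M0 cf dG G0; pose N := M + 1.
have cG : continuous G.
  by move=> t; apply/differentiable_continuous/derivable1_diffP; apply: ex_derive.
have -> : (fun t : R => (f t)%:E) = (fun t : R => (f t)%:E) \_ `[- N, N].
  apply/funext => t; rewrite patchE; case: ifPn => // /negP tN.
  rewrite (G0 t _).2// ltNge; apply/negP => tM; apply: tN.
  by rewrite inE /= in_itv /= -ler_norml (le_trans tM)// /N lerDl.
rewrite -integral_mkcond (@continuous_FTC2 _ f G).
- rewrite (G0 N _).1 ?(G0 (- N) _).1 ?subee//.
  + by rewrite normrN ger0_norm /N; lra.
  + by rewrite ger0_norm /N; lra.
- by rewrite /N; lra.
- exact: continuous_subspaceT.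
- split.
  + by move=> x _; apply: ex_derive.
  + by apply: cvg_at_right_filter; exact: cG.
  + by apply: cvg_at_left_filter; exact: cG.
- by move=> x _; rewrite derive1E; apply: derive_val.
Qed.

(** Both difference quotients are the same function of [h], so existence and value of the limit
    transfer together. *)
Lemma is_derive_line F x v (t d : R) : is_derive (x + t *: v) v F d ->
  is_derive t 1 (fun s : R => F (x + s *: v)) d.
Proof.
move=> [dF dE].
have E : (fun h : R => h^-1 *: ((F \o shift (x + t *: v)) (h *: v) - F (x + t *: v)))
  = (fun h : R => h^-1 *: (((fun s : R => F (x + s *: v)) \o shift t) (h *: 1) - F (x + t *: v))).
  apply/funext => h /=; congr (_ *: (F _ - _)).
  by rewrite scalerDl [h *: 1]mulr1 addrCA addrC.
split; first by rewrite /derivable -E.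
by rewrite /derive -E.
Qed.

(** Starting the line on a coordinate plane makes its parameter equal to the moving coordinate, so
    the slice integrals take the shape that Fubini produces. *)
Lemma line_x1 (im : (0 < 3)%N) (t b c : R) :
  (0, b, c) + t *: basis_vec (Ordinal im) = (t, b, c) :> space3 R.
Proof.
apply: space3_eq.
- by change (0 + t * 1 = t); rewrite mulr1 add0r.
- by change (b + t * 0 = b); rewrite mulr0 addr0.
- by change (c + t * 0 = c); rewrite mulr0 addr0.
Qed.

Lemma line_x2 (im : (1 < 3)%N) (t a c : R) :
  (a, 0, c) + t *: basis_vec (Ordinal im) = (a, t, c) :> space3 R.
Proof.
apply: space3_eq.
- by change (a + t * 0 = a); rewrite mulr0 addr0.
- by change (0 + t * 1 = t); rewrite mulr1 add0r.
- by change (c + t * 0 = c); rewrite mulr0 addr0.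
Qed.

Lemma line_x3 (im : (2 < 3)%N) (t a b : R) :
  (a, b, 0) + t *: basis_vec (Ordinal im) = (a, b, t) :> space3 R.
Proof.
apply: space3_eq.
- by change (a + t * 0 = a); rewrite mulr0 addr0.
- by change (b + t * 0 = b); rewrite mulr0 addr0.
- by change (0 + t * 1 = t); rewrite mulr1 add0r.
Qed.

(** On each line parallel to axis [i], the integral of [dF] is a difference of two values of [F]
    outside [K], hence 0. Applied to the three components of a field, this gives its divergence
    integral 0. *)
Lemma integral_partial_eq0 (i : 'I_3) K F (dF : space3 R -> R) : compact K ->
  (forall x, ~ K x -> F x = 0) -> (forall x, ~ K x -> dF x = 0) ->
  continuous dF -> (forall x, is_derive x (basis_vec i) F (dF x)) ->
  (\int[@lebesgue3 R]_x (dF x)%:E = 0)%E.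
Proof.
move=> cK F0 dF0 cdF dF_.
have [C gC] := compact_support_bounded cK cdF dF0.
have [M M0 KM] := compact_sub_cube cK.
have ncube x : ~ cube M x -> F x = 0 /\ dF x = 0.
  by move=> nx; split; [apply: F0|apply: dF0] => /KM.
have n2 x : ~ cube M x -> dF x = 0 by move=> /ncube[].
have slice (x : space3 R) : (forall t, M < `|t| -> ~ cube M (x + t *: basis_vec i)) ->
    (\int[mu]_t (dF (x + t *: basis_vec i))%:E = 0)%E.
  move=> hx; apply: (@integral_derive_eq0 (fun t => F (x + t *: basis_vec i)) _ M) => //.
  - move=> t; apply: (@continuous_comp _ _ _ (fun t : R => x + t *: basis_vec i) dF).
      by apply: cvgD; [exact: cvg_cst|apply: cvgZl; exact: cvg_id].
    exact: cdF.
  - by move=> t; apply: is_derive_line.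
  - by move=> t Mt; apply/ncube/hx.
case: i dF_ slice => -[|[|[|//]]] im dF_ slice.
- apply: (lebesgue3_eq0_x1 cdF gC n2) => b c.
  under eq_integral do rewrite -(line_x1 im).
  by apply: slice => t; rewrite line_x1 => Mt -[/=]; rewrite leNgt Mt.
- apply: (lebesgue3_eq0_x2 cdF gC n2) => a c.
  under eq_integral do rewrite -(line_x2 im).
  by apply: slice => t; rewrite line_x2 => Mt -[_ /=]; rewrite leNgt Mt.
- apply: (lebesgue3_eq0_x3 cdF gC n2) => a b.
  under eq_integral do rewrite -(line_x3 im).
  by apply: slice => t; rewrite line_x3 => Mt -[_ _ /=]; rewrite leNgt Mt.
Qed.

Lemma integrable_compact_support K g : compact K -> continuous g ->
  (forall x, ~ K x -> g x = 0) -> (@lebesgue3 R).-integrable setT (EFin \o g).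
Proof.
move=> cK cg g0; have [C gC] := compact_support_bounded cK cg g0.
have [M M0 KM] := compact_sub_cube cK.
by apply: (@integrable_cube M C g cg gC) => x nx; apply: g0 => Kx; exact/nx/KM.
Qed.

End CompactSupportIntegrals.

(** * Differentiation rules *)

Section OneDimensionalCalculus.
Context {R : realType}.

Lemma near_eq_cvg_to {T : Type} {F : set_system T} {FF : Filter F} (f g : T -> R)
    (l : R) : (\forall t \near F, f t = g t) -> f @ F --> l -> g @ F --> l.
Proof. by move=> fg fl; apply: (cvg_trans _ fl); exact: near_eq_cvg. Qed.

Lemma is_derive_lim {V : normedModType R} (f : V -> R) (x v : V) (d : R) :
  (h^-1 * (f (h *: v + x) - f x)) @[h --> 0^'] --> d -> is_derive x v f d.
Proof.
move=> fd; apply: DeriveDef; first by apply/cvg_ex; exists d.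
exact: cvg_lim.
Qed.

Section Rules.
Context {V : normedModType R}.
Implicit Types (f g : V -> R) (x v : V).

(** Restricting [f] to the line [s *: v + x] reduces this to the chain rule for functions of one
    real variable at [s = 0]. *)
Lemma is_derive_comp1 (g : R -> R) f x v (a b : R) :
  is_derive x v f a -> is_derive (f x) 1 g b -> is_derive x v (g \o f) (b * a).
Proof.
move=> [fx fa] gb.
have lineE (k : V -> R) : (fun h : R => h^-1 *: ((k \o shift x) (h *: v) - k x)) =
    (fun h : R => h^-1 *: (((fun s : R => k (s *: v + x)) \o shift 0) (h *: 1)
      - k (0 *: v + x))).
  apply/funext => h /=; congr (_ *: (k _ - k _)).
    by rewrite addr0 [h *: 1]mulr1.
  by rewrite scale0r add0r.
have dl : is_derive (0 : R) 1 (fun s : R => f (s *: v + x)) a.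
  split; first by rewrite /derivable -lineE.
  by rewrite /derive -lineE.
have gb0 : is_derive (f ((0 : R) *: v + x)) 1 g b by rewrite scale0r add0r.
have [dg eg] := is_derive1_comp gb0 dl.
by split; [rewrite /derivable lineE|rewrite /derive lineE].
Qed.

Lemma is_derive_add f g x v (a b : R) : is_derive x v f a -> is_derive x v g b ->
  is_derive x v (fun z => f z + g z) (a + b).
Proof. by move=> fa gb; exact: is_deriveD. Qed.

Lemma is_derive_opp f x v (a : R) : is_derive x v f a ->
  is_derive x v (fun z => - f z) (- a).
Proof. by move=> fa; exact: is_deriveN. Qed.

Lemma is_derive_mul f g x v (a b : R) : is_derive x v f a -> is_derive x v g b ->
  is_derive x v (fun z => f z * g z) (a * g x + f x * b).
Proof.
move=> fa gb; apply: (is_derive_eq (is_deriveM fa gb)).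
by rewrite addrC [g x *: a]mulrC.
Qed.

Lemma is_derive_inv f x v (a : R) : f x != 0 -> is_derive x v f a ->
  is_derive x v (fun z => (f z)^-1) (- a / (f x) ^+ 2).
Proof.
move=> fx0 [df da]; split; first exact: derivableV.
by rewrite deriveV// da [LHS]mulrC mulNr mulrN.
Qed.

End Rules.

Lemma is_derive_continuous (f : R -> R) (t d : R) : is_derive t 1 f d ->
  {for t, continuous f}.
Proof. by case=> df _; apply/differentiable_continuous/derivable1_diffP. Qed.

Lemma powR_norm_cvg0 (q : R) : 0 < q -> `|s| `^ q @[s --> (0 : R)] --> (0 : R).
Proof.
move=> q0; apply/cvgr0Pnorm_lt => e e0.
have e0' : 0 < e `^ q^-1 by rewrite powR_gt0.
near=> s; rewrite ger0_norm ?powR_ge0//.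
have se : `|s| < e `^ q^-1.
  by near: s; apply: (@cvgr0_norm_lt _ _ _ _ _ id) => //; exact: cvg_id.
have -> : e = (e `^ q^-1) `^ q by rewrite -powRrM mulVf ?gt_eqF// powRr1// ltW.
by rewrite gt0_ltr_powR// nnegrE ltW.
Unshelve. all: by end_near. Qed.

Lemma norm_mul_powR (q s : R) : 0 < q -> `|s * `|s| `^ (q - 1)| = `|s| `^ q.
Proof.
by move=> q0; rewrite normrM norm_powR// normr_id mulr_powRB1.
Qed.

Lemma continuous_norm_powR (q s : R) : s != 0 ->
  {for s, continuous (fun u : R => `|u| `^ q)}.
Proof.
move=> s0; apply: (@continuous_comp _ _ _ (fun u : R => `|u|) (fun u => u `^ q)).
  exact: norm_continuous.
apply: is_derive_continuous; apply: is_derive1_powR; by rewrite normr_gt0.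
Qed.

(** Serves with [q = p - 1]. If [q < 1] the power is unbounded near 0, but the product has absolute
    value |s|^q and still tends to 0. *)
Lemma continuous_mul_powR (q : R) : 0 < q ->
  continuous (fun s : R => s * `|s| `^ (q - 1)).
Proof.
move=> q0 s; have [->|s0] := eqVneq s 0; last first.
  by apply: cvgM; [exact: cvg_id|exact: continuous_norm_powR].
rewrite /continuous_at mul0r; apply/norm_cvg0P.
apply: (near_eq_cvg_to _ (powR_norm_cvg0 q0)).
by near=> t; rewrite norm_mul_powR.
Unshelve. all: by end_near. Qed.

(** At 0 the difference quotient has absolute value |h|^(p-1), which tends to 0 since [1 < p].
    Elsewhere the chain rule applies with [s / |s|] as derivative of the absolute value. The factor
    [s] lets one formula cover both cases. *)
Lemma is_derive_norm_powR (p s : R) : 1 < p ->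
  is_derive s 1 (fun u : R => `|u| `^ p) (p * (s * `|s| `^ (p - 2))).
Proof.
move=> p1; have p0 : 0 < p by rewrite (lt_trans ltr01).
have [->|s0] := eqVneq s 0.
  apply: is_derive_lim; rewrite mul0r mulr0 normr0 powR0 ?gt_eqF//.
  have q0 : 0 < p - 1 by rewrite subr_gt0.
  apply/norm_cvg0P; apply: (@near_eq_cvg_to _ _ _ (fun t : R => `|t| `^ (p - 1))).
    near=> t; have t0 : t != 0 by near: t; exact: nbhs_dnbhs_neq.
    rewrite addr0 [t *: 1]mulr1 subr0 normrM norm_powR// normr_id normfV.
    rewrite -[in RHS](@mulr_powRB1 _ `|t| p)// mulrA mulVf ?mul1r//.
    by rewrite normr_eq0.
  apply: cvg_trans (powR_norm_cvg0 q0); apply: cvg_app; exact: cvg_within.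
have n0 : 0 < `|s| by rewrite normr_gt0.
have dn : is_derive s 1 (fun u : R => `|u|) (s / `|s|).
  have [s_gt0|s_le0] := ltP 0 s.
    apply: (@near_eq_is_derive _ _ _ id).
      by near=> t; rewrite gtr0_norm//; near: t; exact: lt_nbhsr.
    by rewrite gtr0_norm// divff//; exact: is_derive_id.
  have s_lt0 : s < 0 by rewrite lt_neqAle s0.
  apply: (@near_eq_is_derive _ _ _ (fun t : R => - t)).
    by near=> t; rewrite ltr0_norm//; near: t; exact: lt_nbhsl.
  rewrite ltr0_norm// invrN mulrN divff//.
  by apply: is_derive_opp; exact: is_derive_id.
apply: (is_derive_eq (is_derive_comp1 dn (is_derive1_powR p n0))).
have -> : p - 2 = (p - 1) - 1 by ring.
have ns : `|s| != 0 by rewrite gt_eqF.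
rewrite [X in _ = p * (s * X)]powRB ?ns ?implybT// powRr1 ?ltW//.
by field; exact: ns.
Unshelve. all: by end_near. Qed.

End OneDimensionalCalculus.

(** * Normal coordinates *)

Section NormalCoordinates.
Context {R : realType}.
Implicit Types (x z v : space3 R).

Notation U := (@hyperboloid R `\` hyp_ridge).

(* Off the axis, [x = ray (tau x) (foot x)] where [foot x] is the near point. *)
Definition tau x : R := delta x / enorm (near_point hyperboloid x).
Definition foot1 x : R := x.1.1 / (1 - tau x).
Definition foot2 x : R := x.1.2 / (1 - tau x).
Definition foot3 x : R := x.2 / (1 + tau x).
Definition foot x : space3 R := (foot1 x, foot2 x, foot3 x).
(** On the surface |y|^2 = 1 + 2 y3^2. Using the third coordinate alone keeps this at least 1 at
    every point and makes its derivative depend on [foot3] only. *)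
Definition foot_norm x : R := Num.sqrt (1 + 2 * (foot3 x * foot3 x)).

Lemma foot_norm_sqr x : foot_norm x ^+ 2 = 1 + 2 * (foot3 x * foot3 x).
Proof. by rewrite sqr_sqrtr// addr_ge0// mulr_ge0// -expr2 sqr_ge0. Qed.

Lemma foot_norm_ge1 x : 1 <= foot_norm x.
Proof.
rewrite -[leLHS]sqrtr1 ler_wsqrtr// lerDl mulr_ge0// -expr2 sqr_ge0//.
Qed.

Lemma tau_spec x : U x ->
  [/\ 0 < tau x < 1, on_hyperboloid (foot x) & near_point hyperboloid x = foot x].
Proof.
move=> /ray_ex[t [y [t01 by_ E]]]; have /andP[t0 t1] := t01.
have w1 := on_hyperboloid_enorm_ge1 by_.
have tE : tau x = t.
  rewrite /tau E delta_ray ?ltW// near_point_ray ?t1 ?ltW// mulfK//.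
  by rewrite gt_eqF// (lt_le_trans _ w1).
have fE : foot x = y.
  rewrite /foot /foot1 /foot2 /foot3 tE E; apply: space3_eq; rewrite /= mulrC mulKf//; lra.
rewrite tE fE; split => //.
by rewrite E near_point_ray// t1 ltW.
Qed.

Lemma enorm_foot x : on_hyperboloid (foot x) -> enorm (foot x) = foot_norm x.
Proof. by rewrite /enorm /foot_norm /dot /on_hyperboloid /= => h; congr Num.sqrt; lra. Qed.

Lemma delta_tau x : U x -> delta x = tau x * foot_norm x.
Proof.
move=> Ux; have [_ b E] := tau_spec Ux.
rewrite /tau E enorm_foot// divfK// gt_eqF//.
exact: (lt_le_trans ltr01 (foot_norm_ge1 x)).
Qed.

(* The divided difference between [s] and [t] of the function
   [r^2 / (1 - t)^2 - x3^2 / (1 + t)^2], whose level 1 defines [tau]. *)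
Definition slope x (s t : R) : R :=
  (x.1.1 * x.1.1 + x.1.2 * x.1.2) * (2 - s - t) / ((1 - s) ^+ 2 * (1 - t) ^+ 2)
  + x.2 * x.2 * (2 + s + t) / ((1 + s) ^+ 2 * (1 + t) ^+ 2).

(** The change of the same level function when the point moves from [x] to [z] and the parameter [s]
    stays fixed. *)
Definition defect x z (s : R) : R :=
  (z.1.1 * z.1.1 + z.1.2 * z.1.2 - (x.1.1 * x.1.1 + x.1.2 * x.1.2)) / (1 - s) ^+ 2
  - (z.2 * z.2 - x.2 * x.2) / (1 + s) ^+ 2.

(** The level function is 1 at both [(x, tau x)] and [(z, tau z)], so its change in the parameter
    cancels its change in the point. This exact identity takes the place of the implicit function
    theorem. *)
Lemma tau_increment x z : U x -> U z ->
  (tau z - tau x) * slope z (tau x) (tau z) = - defect x z (tau x).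
Proof.
move=> /tau_spec[/andP[s0 s1] bs _] /tau_spec[/andP[t0 t1] bt _].
move: bs bt; rewrite /on_hyperboloid /foot /= /foot1 /foot2 /foot3 /slope /defect.
move: (tau x) (tau z) s0 s1 t0 t1 => s t s0 s1 t0 t1.
case: x => [[a b] c]; case: z => [[a' b'] c'] /= bs bt.
have [? ? ? ?] : [/\ 1 - s != 0, 1 + s != 0, 1 - t != 0 & 1 + t != 0].
  by split; lra.
transitivity ((((a' / (1 - t)) ^+ 2 + (b' / (1 - t)) ^+ 2 - (c' / (1 + t)) ^+ 2)
   - ((a / (1 - s)) ^+ 2 + (b / (1 - s)) ^+ 2 - (c / (1 + s)) ^+ 2))
   - ((a' * a' + b' * b' - (a * a + b * b)) / (1 - s) ^+ 2 - (c' * c' - c * c) / (1 + s) ^+ 2)).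
  by field; do !(apply/andP; split).
by rewrite bs bt !addrK subrr sub0r.
Qed.

(** Here [2 - s - t >= 1 - s], the denominators are at most 1 and the second summand is nonnegative.
    The bound is free of [t], so it applies to [t = tau z] before anything is known about the
    variation of [tau]. *)
Lemma slope_ge z (s t : R) : 0 < s < 1 -> 0 < t < 1 ->
  (z.1.1 * z.1.1 + z.1.2 * z.1.2) * (1 - s) <= slope z s t.
Proof.
move=> /andP[s0 s1] /andP[t0 t1].
have r0 : 0 <= z.1.1 * z.1.1 + z.1.2 * z.1.2 by rewrite addr_ge0// -expr2 sqr_ge0.
rewrite /slope; apply: ler_wpDr.
  have c0 : 0 <= z.2 * z.2 by rewrite -expr2 sqr_ge0.
  by rewrite divr_ge0// mulr_ge0// ?sqr_ge0//; lra.
have d0 : 0 < (1 - s) ^+ 2 * (1 - t) ^+ 2 by rewrite mulr_gt0// exprn_gt0// subr_gt0.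
rewrite ler_pdivlMr// -!mulrA ler_wpM2l//.
apply: (@le_trans _ _ (1 - s)); last by lra.
rewrite ger_pMr ?subr_gt0//.
have v1 : (1 - t) ^+ 2 <= 1 by apply: exprn_ile1; lra.
apply: mulr_ile1; [lra|apply: mulr_ge0; [lra|exact: sqr_ge0]|lra|].
by apply: mulr_ile1 => //; [lra|exact: sqr_ge0|lra].
Qed.

Lemma hyp_regular_radius x : U x -> 0 < x.1.1 * x.1.1 + x.1.2 * x.1.2.
Proof.
move=> [_ nr]; rewrite -!expr2 lt_neqAle addr_ge0 ?sqr_ge0// andbT eq_sym.
apply/eqP => /eqP; rewrite paddr_eq0 ?sqr_ge0// !sqrf_eq0.
by move=> /andP[/eqP ? /eqP ?]; apply: nr.
Qed.

Lemma near_hyp_regular x : U x -> \forall z \near x, U z.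
Proof. by move=> Ux; apply: open_nbhs_nbhs; split => //; exact: open_hyp_regular. Qed.

Lemma tau_continuous x : U x -> {for x, continuous tau}.
Proof.
move=> Ux; have [s01 _ _] := tau_spec Ux; have /andP[s0 s1] := s01.
have r0 := hyp_regular_radius Ux.
(* A majorant of the distance between [tau z] and [tau x], from [tau_increment] and [slope_ge]; it
   does not involve [tau z] and is visibly continuous at [x], with value 0. *)
pose bnd z := `|defect x z (tau x)| *
  ((z.1.1 * z.1.1 + z.1.2 * z.1.2) * (1 - tau x))^-1.
have bnd0 : bnd z @[z --> x] --> (0 : R).
  have -> : 0 = bnd x by rewrite /bnd /defect !subrr !mul0r subrr normr0 mul0r.
  apply: cvgM.
    apply: cvg_norm; apply: cvgB; apply: cvgM; try exact: cvg_cst.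
      apply: cvgB; last exact: cvg_cst.
      by apply: cvgD; apply: cvgM; do ?[exact: continuous_x1|exact: continuous_x2].
    by apply: cvgB; [apply: cvgM; exact: continuous_x3|exact: cvg_cst].
  apply: cvgV; first by rewrite mulf_neq0// gt_eqF// subr_gt0.
  apply: cvgM; last exact: cvg_cst.
  by apply: cvgD; apply: cvgM; do ?[exact: continuous_x1|exact: continuous_x2].
have lo : (tau x - bnd z) @[z --> x] --> tau x.
  have H : (tau x - bnd z) @[z --> x] --> tau x - 0.
    by apply: cvgB => //; exact: cvg_cst.
  by rewrite subr0 in H.
have hi : (tau x + bnd z) @[z --> x] --> tau x.
  have H : (tau x + bnd z) @[z --> x] --> tau x + 0.
    by apply: cvgD => //; exact: cvg_cst.
  by rewrite addr0 in H.
apply: (@squeeze_cvgr _ _ _ _ (fun z => tau x - bnd z) (fun z => tau x + bnd z));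
  [|exact: lo|exact: hi].
near=> z; rewrite -ler_distl.
have Uz : U z by near: z; exact: near_hyp_regular.
have [t01 _ _] := tau_spec Uz; have r0' := hyp_regular_radius Uz.
have g0 : 0 < (z.1.1 * z.1.1 + z.1.2 * z.1.2) * (1 - tau x).
  by rewrite mulr_gt0// subr_gt0.
rewrite /bnd ler_pdivlMr// -[leRHS]normrN -(tau_increment Ux Uz) normrM.
rewrite ler_wpM2l// (le_trans (slope_ge z s01 t01))// ler_norm.
Unshelve. all: by end_near. Qed.

(** Minus the derivative of the level function along [v], divided by its derivative in the
    parameter, in foot coordinates. The denominator is (1 - tau^2) / 2 times the diagonal value of
    [slope]. *)
Definition dtau v x : R :=
  - ((1 + tau x) * (foot1 x * v.1.1 + foot2 x * v.1.2) - (1 - tau x) * (foot3 x * v.2))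
    / (foot_norm x ^+ 2 + tau x).

(** The left side is the limit of the difference quotient of [tau] at [ray t (a, b, c)] in direction
    [(p, q, r)]. *)
Lemma dtau_limit_eq (t a b c p q r : R) : 0 < t < 1 ->
  a ^+ 2 + b ^+ 2 = 1 + c ^+ 2 ->
  - (2 * ((1 - t) * a * p + (1 - t) * b * q) / (1 - t) ^+ 2
     - 2 * ((1 + t) * c * r) / (1 + t) ^+ 2)
   * (((1 - t) * a * ((1 - t) * a) + (1 - t) * b * ((1 - t) * b)) * (2 - t - t)
      / ((1 - t) ^+ 2 * (1 - t) ^+ 2)
      + (1 + t) * c * ((1 + t) * c) * (2 + t + t) / ((1 + t) ^+ 2 * (1 + t) ^+ 2))^-1
  = - ((1 + t) * (a * p + b * q) - (1 - t) * (c * r)) / (1 + 2 * (c * c) + t).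
Proof.
move=> /andP[t0 t1] h.
have m0 : 1 - t != 0 by lra.
have p0 : 1 + t != 0 by lra.
have W0 : 1 + 2 * (c * c) + t != 0 by have := sqr_ge0 c; nra.
have -> : ((1 - t) * a * ((1 - t) * a) + (1 - t) * b * ((1 - t) * b)) * (2 - t - t)
      / ((1 - t) ^+ 2 * (1 - t) ^+ 2)
      + (1 + t) * c * ((1 + t) * c) * (2 + t + t) / ((1 + t) ^+ 2 * (1 + t) ^+ 2)
      = 2 * (1 + 2 * (c * c) + t) / ((1 - t) * (1 + t)).
  transitivity (2 * (a ^+ 2 + b ^+ 2) / (1 - t) + 2 * c ^+ 2 / (1 + t)).
    by field; rewrite m0 p0.
  by rewrite h; field; rewrite m0 p0.
by field; rewrite W0 m0 p0.
Qed.

Lemma tau_is_derive v x : U x -> is_derive x v tau (dtau v x).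
Proof.
move=> Ux; have [t01 bx _] := tau_spec Ux; have /andP[t0 t1] := t01.
have r0 := hyp_regular_radius Ux.
have sl0 : 0 < slope x (tau x) (tau x).
  by apply: lt_le_trans (slope_ge x t01 t01); rewrite mulr_gt0// subr_gt0.
have gx : h *: v + x @[h --> (0 : R)] --> x.
  suff : h *: v + x @[h --> (0 : R)] --> (0 : R) *: v + x by rewrite scale0r add0r.
  by apply: cvgD; [apply: cvgZl; exact: cvg_id|exact: cvg_cst].
have g1 := cvg_comp _ _ gx (@continuous_x1 R x).
have g2 := cvg_comp _ _ gx (@continuous_x2 R x).
have g3 := cvg_comp _ _ gx (@continuous_x3 R x).
have gt := cvg_comp _ _ gx (tau_continuous Ux).
apply: is_derive_lim.
(* This is [tau_increment] solved for the quotient: the numerators of [defect] are divisible by [h],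
   and after cancellation the expression is continuous at [h = 0], so the limit is [q 0]. *)
pose q (h : R) := - ((2 * (x.1.1 * v.1.1 + x.1.2 * v.1.2)
     + h * (v.1.1 * v.1.1 + v.1.2 * v.1.2)) / (1 - tau x) ^+ 2
     - (2 * (x.2 * v.2) + h * (v.2 * v.2)) / (1 + tau x) ^+ 2)
   * (slope (h *: v + x) (tau x) (tau (h *: v + x)))^-1.
have gU : \forall h \near (0 : R), U (h *: v + x) by apply: gx; exact: near_hyp_regular.
apply: (@near_eq_cvg_to _ _ _ _ q).
  near=> h.
  have h0 : h != 0 by near: h; exact: nbhs_dnbhs_neq.
  have Uh : U (h *: v + x) by near: h; apply: cvg_within; exact: gU.
  have [s01 _ _] := tau_spec Uh; have r0' := hyp_regular_radius Uh.
  have slh : slope (h *: v + x) (tau x) (tau (h *: v + x)) != 0.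
    apply: lt0r_neq0; apply: lt_le_trans (slope_ge _ t01 s01).
    by rewrite mulr_gt0// subr_gt0; case/andP: t01.
  have inc := tau_increment Ux Uh.
  rewrite /q; apply: (mulIf slh); rewrite mulfVK// -mulrA inc.
  rewrite /defect.
  change (h *: v + x).1.1 with (h * v.1.1 + x.1.1).
  change (h *: v + x).1.2 with (h * v.1.2 + x.1.2).
  change (h *: v + x).2 with (h * v.2 + x.2).
  have m0 : 1 - tau x != 0 by lra.
  have p0 : 1 + tau x != 0 by lra.
  by field; rewrite m0 p0 h0.
apply: cvg_trans; first by apply: cvg_app; exact: cvg_within.
have -> : dtau v x = q 0.
  have L := dtau_limit_eq v.1.1 v.1.2 v.2 t01 (bx : foot1 x ^+ 2 + foot2 x ^+ 2 = 1 + foot3 x ^+ 2).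
  have E1 : (1 - tau x) * foot1 x = x.1.1 by rewrite /foot1 mulrC divfK//; lra.
  have E2 : (1 - tau x) * foot2 x = x.1.2 by rewrite /foot2 mulrC divfK//; lra.
  have E3 : (1 + tau x) * foot3 x = x.2 by rewrite /foot3 mulrC divfK//; lra.
  rewrite E1 E2 E3 in L.
  by rewrite /dtau foot_norm_sqr -L /q !mul0r !addr0 scale0r add0r.
apply: cvgM.
  apply: cvgN; apply: cvgB; apply: cvgM; try exact: cvg_cst.
    by apply: cvgD; [exact: cvg_cst|apply: cvgM; [exact: cvg_id|exact: cvg_cst]].
  by apply: cvgD; [exact: cvg_cst|apply: cvgM; [exact: cvg_id|exact: cvg_cst]].
apply: cvgV; first by rewrite scale0r add0r gt_eqF.
rewrite scale0r add0r; rewrite /slope.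
have c1 : (1 - tau (h *: v + x)) ^+ 2 @[h --> (0 : R)] --> (1 - tau x) ^+ 2.
  by apply: cvgM; apply: cvgB => //; exact: cvg_cst.
have c2 : (1 + tau (h *: v + x)) ^+ 2 @[h --> (0 : R)] --> (1 + tau x) ^+ 2.
  by apply: cvgM; apply: cvgD => //; exact: cvg_cst.
apply: cvgD; apply: cvgM.
- apply: cvgM; first by apply: cvgD; apply: cvgM.
  by apply: cvgB => //; exact: cvg_cst.
- apply: cvgV; first by rewrite mulf_neq0// sqrf_eq0; lra.
  by apply: cvgM => //; exact: cvg_cst.
- apply: cvgM; first by apply: cvgM.
  by apply: cvgD => //; exact: cvg_cst.
- apply: cvgV; first by rewrite mulf_neq0// sqrf_eq0; lra.
  by apply: cvgM => //; exact: cvg_cst.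
Unshelve. all: by end_near. Qed.

End NormalCoordinates.

(** * Gradient and Laplacian of the distance *)

Section NormalDerivatives.
Context {R : realType}.
Implicit Types (x z v : space3 R).

Notation U := (@hyperboloid R `\` hyp_ridge).

Lemma is_derive_x1 x v : is_derive x v (fun z : space3 R => z.1.1) v.1.1.
Proof.
apply: is_derive_lim; apply: (@near_eq_cvg_to _ _ _ _ (fun=> v.1.1)).
  near=> h; have h0 : h != 0 by near: h; exact: nbhs_dnbhs_neq.
  change (v.1.1 = h^-1 * (h * v.1.1 + x.1.1 - x.1.1)).
  by rewrite addrK mulKf.
exact: cvg_cst.
Unshelve. all: by end_near. Qed.

Lemma is_derive_x2 x v : is_derive x v (fun z : space3 R => z.1.2) v.1.2.
Proof.
apply: is_derive_lim; apply: (@near_eq_cvg_to _ _ _ _ (fun=> v.1.2)).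
  near=> h; have h0 : h != 0 by near: h; exact: nbhs_dnbhs_neq.
  change (v.1.2 = h^-1 * (h * v.1.2 + x.1.2 - x.1.2)).
  by rewrite addrK mulKf.
exact: cvg_cst.
Unshelve. all: by end_near. Qed.

Lemma is_derive_x3 x v : is_derive x v (fun z : space3 R => z.2) v.2.
Proof.
apply: is_derive_lim; apply: (@near_eq_cvg_to _ _ _ _ (fun=> v.2)).
  near=> h; have h0 : h != 0 by near: h; exact: nbhs_dnbhs_neq.
  change (v.2 = h^-1 * (h * v.2 + x.2 - x.2)).
  by rewrite addrK mulKf.
exact: cvg_cst.
Unshelve. all: by end_near. Qed.

Definition dfoot1 v x : R := (v.1.1 + foot1 x * dtau v x) / (1 - tau x).
Definition dfoot2 v x : R := (v.1.2 + foot2 x * dtau v x) / (1 - tau x).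
Definition dfoot3 v x : R := (v.2 - foot3 x * dtau v x) / (1 + tau x).
Definition dfoot_norm v x : R := 2 * foot3 x * dfoot3 v x / foot_norm x.

Lemma tau_neq x : U x -> [/\ 1 - tau x != 0, 1 + tau x != 0 & foot_norm x != 0].
Proof.
move=> /tau_spec[/andP[t0 t1] _ _]; have w1 := foot_norm_ge1 x.
by split; lra.
Qed.

Lemma foot1_is_derive v x : U x -> is_derive x v foot1 (dfoot1 v x).
Proof.
move=> Ux; have [m0 p0 _] := tau_neq Ux.
have dm : is_derive x v (fun z => 1 - tau z) (- dtau v x).
  apply: (is_derive_eq (is_derive_add (is_derive_cst (1 : R) x v)
    (is_derive_opp (tau_is_derive v Ux)))).
  by rewrite add0r.
have -> : dfoot1 v x = v.1.1 * (1 - tau x)^-1 + x.1.1 * (- - dtau v x / (1 - tau x) ^+ 2).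
  by rewrite /dfoot1 /foot1; field.
exact: (is_derive_mul (is_derive_x1 x v) (@is_derive_inv _ _ (fun z => 1 - tau z) _ _ _ m0 dm)).
Qed.

Lemma foot2_is_derive v x : U x -> is_derive x v foot2 (dfoot2 v x).
Proof.
move=> Ux; have [m0 p0 _] := tau_neq Ux.
have dm : is_derive x v (fun z => 1 - tau z) (- dtau v x).
  apply: (is_derive_eq (is_derive_add (is_derive_cst (1 : R) x v)
    (is_derive_opp (tau_is_derive v Ux)))).
  by rewrite add0r.
have -> : dfoot2 v x = v.1.2 * (1 - tau x)^-1 + x.1.2 * (- - dtau v x / (1 - tau x) ^+ 2).
  by rewrite /dfoot2 /foot2; field.
exact: (is_derive_mul (is_derive_x2 x v) (@is_derive_inv _ _ (fun z => 1 - tau z) _ _ _ m0 dm)).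
Qed.

Lemma foot3_is_derive v x : U x -> is_derive x v foot3 (dfoot3 v x).
Proof.
move=> Ux; have [m0 p0 _] := tau_neq Ux.
have dp : is_derive x v (fun z => 1 + tau z) (dtau v x).
  apply: (is_derive_eq (is_derive_add (is_derive_cst (1 : R) x v) (tau_is_derive v Ux))).
  by rewrite add0r.
have -> : dfoot3 v x = v.2 * (1 + tau x)^-1 + x.2 * (- dtau v x / (1 + tau x) ^+ 2).
  by rewrite /dfoot3 /foot3; field.
exact: (is_derive_mul (is_derive_x3 x v) (@is_derive_inv _ _ (fun z => 1 + tau z) _ _ _ p0 dp)).
Qed.

Lemma foot_norm_is_derive v x : U x -> is_derive x v foot_norm (dfoot_norm v x).
Proof.
move=> Ux; have [m0 p0 w0] := tau_neq Ux.
have d3 := foot3_is_derive v Ux.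
have dq := is_derive_add (is_derive_cst (1 : R) x v)
  (is_derive_mul (is_derive_cst (2 : R) x v) (is_derive_mul d3 d3)).
have q0 : 0 < 1 + 2 * (foot3 x * foot3 x).
  by rewrite -foot_norm_sqr exprn_gt0// (lt_le_trans ltr01 (foot_norm_ge1 x)).
apply: (is_derive_eq (is_derive_comp1 dq (is_derive1_sqrt q0))).
rewrite -/(foot_norm x) /dfoot_norm /=; field; exact: w0.
Qed.

Definition normal1 x : R := - foot1 x / foot_norm x.
Definition normal2 x : R := - foot2 x / foot_norm x.
Definition normal3 x : R := foot3 x / foot_norm x.
Definition normal x : space3 R := (normal1 x, normal2 x, normal3 x).

Lemma foot_on_hyperboloid x : U x -> foot1 x * foot1 x + foot2 x * foot2 x = 1 + foot3 x * foot3 x.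
Proof. by move=> /tau_spec[_ + _]; rewrite /on_hyperboloid /foot /= !expr2. Qed.

Lemma normal_unit x : U x -> dot (normal x) (normal x) = 1.
Proof.
move=> Ux; have [_ _ w0] := tau_neq Ux; have h := foot_on_hyperboloid Ux.
rewrite /dot /normal /normal1 /normal2 /normal3 /=.
transitivity ((foot1 x * foot1 x + foot2 x * foot2 x + foot3 x * foot3 x) 
  / foot_norm x ^+ 2); first by field.
by rewrite h foot_norm_sqr; field; rewrite -foot_norm_sqr sqrf_eq0.
Qed.

Lemma delta_is_derive v x : U x -> is_derive x v delta (dot (normal x) v).
Proof.
move=> Ux; have [m0 p0 w0] := tau_neq Ux.
apply: (@near_eq_is_derive _ _ _ (fun z => tau z * foot_norm z)).
  by near=> z; rewrite delta_tau//; near: z; exact: near_hyp_regular.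
apply: (is_derive_eq (is_derive_mul (tau_is_derive v Ux) (foot_norm_is_derive v Ux))).
rewrite /dfoot_norm /dfoot3 /dot /normal /normal1 /normal2 /normal3 /=.
have W0 : foot_norm x ^+ 2 + tau x != 0.
  have /tau_spec[/andP[t0 _] _ _] := Ux; have := foot_norm_ge1 x; nra.
(* With this substitution the coefficient of [dtau] becomes [foot_norm x ^+ 2 + tau x], exactly the
   denominator of [dtau]. *)
have c2 : 2 * (foot3 x * foot3 x) = foot_norm x ^+ 2 - 1 by rewrite foot_norm_sqr addrC addKr.
transitivity (dtau v x * (foot_norm x ^+ 2 * (1 + tau x) - tau x * (2 * (foot3 x * foot3 x)))
    / (foot_norm x * (1 + tau x)) + 2 * tau x * foot3 x * v.2 / (foot_norm x * (1 + tau x))).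
  by field; rewrite p0 w0.
by rewrite c2 /dtau; field; rewrite W0 p0 w0.
Unshelve. all: by end_near. Qed.

Definition dnormal1 v x : R :=
  - (dfoot1 v x / foot_norm x) + foot1 x * dfoot_norm v x / foot_norm x ^+ 2.
Definition dnormal2 v x : R :=
  - (dfoot2 v x / foot_norm x) + foot2 x * dfoot_norm v x / foot_norm x ^+ 2.
Definition dnormal3 v x : R :=
  dfoot3 v x / foot_norm x - foot3 x * dfoot_norm v x / foot_norm x ^+ 2.

Lemma normal1_is_derive v x : U x -> is_derive x v normal1 (dnormal1 v x).
Proof.
move=> Ux; have [_ _ w0] := tau_neq Ux.
apply: (is_derive_eq (is_derive_mul (is_derive_opp (foot1_is_derive v Ux))
  (is_derive_inv w0 (foot_norm_is_derive v Ux)))).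
by rewrite /dnormal1; field.
Qed.

Lemma normal2_is_derive v x : U x -> is_derive x v normal2 (dnormal2 v x).
Proof.
move=> Ux; have [_ _ w0] := tau_neq Ux.
apply: (is_derive_eq (is_derive_mul (is_derive_opp (foot2_is_derive v Ux))
  (is_derive_inv w0 (foot_norm_is_derive v Ux)))).
by rewrite /dnormal2; field.
Qed.

Lemma normal3_is_derive v x : U x -> is_derive x v normal3 (dnormal3 v x).
Proof.
move=> Ux; have [_ _ w0] := tau_neq Ux.
apply: (is_derive_eq (is_derive_mul (foot3_is_derive v Ux)
  (is_derive_inv w0 (foot_norm_is_derive v Ux)))).
by rewrite /dnormal3; field.
Qed.

(** With d = tau w this is 1 / (w^3 + d) - 1 / (w - d) with the factor 1 / w taken out. *)
Definition laplacian_delta x : R := ((foot_norm x ^+ 2 + tau x)^-1 - (1 - tau x)^-1) / foot_norm x.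

Lemma divergence_normal x : U x ->
  dnormal1 (1, 0, 0) x + dnormal2 (0, 1, 0) x + dnormal3 (0, 0, 1) x = laplacian_delta x.
Proof.
move=> Ux; have [m0 p0 w0] := tau_neq Ux; have h := foot_on_hyperboloid Ux.
have W0 : foot_norm x ^+ 2 + tau x != 0.
  have /tau_spec[/andP[t0 _] _ _] := Ux; have := foot_norm_ge1 x; nra.
rewrite /laplacian_delta /dnormal1 /dnormal2 /dnormal3 /dfoot_norm /dfoot1 /dfoot2 /dfoot3 /dtau /=.
have e2 := foot_norm_sqr x.
move: (tau x) (foot_norm x) (foot1 x) (foot2 x) (foot3 x) 
  m0 p0 w0 h W0 e2 => t w a b c m0 p0 w0 h W0 e2.
(* In this grouping [a] and [b] occur only through [a * a + b * b], so [h] and [e2] leave an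
   identity in [c] and [t] inside the quotient by [w]. *)
transitivity ((- (2 - (1 + t) * (a * a + b * b) / (w ^+ 2 + t)) / (1 - t)
  + (1 - (1 - t) * (c * c) / (w ^+ 2 + t)) / (1 + t)
  + (2 * (c * c) * (1 + t) * (a * a + b * b) / (w ^+ 2 + t)
     - 2 * (c * c) * (1 - (1 - t) * (c * c) / (w ^+ 2 + t))) / ((1 + t) * w ^+ 2)) / w).
  by field; rewrite W0 w0 m0 p0.
have w20 : w ^+ 2 != 0 by rewrite sqrf_eq0.
congr (_ / _); rewrite h; move: W0 w20; rewrite e2 => W0 w20.
by field; rewrite W0 w20 m0 p0.
Qed.

(** Replaces the chosen near point by [foot_norm], which has an explicit formula whose continuity
    can be proved. *)
Definition kappa_foot x : R := - (foot_norm x ^+ 3 - delta x)^-1 + (foot_norm x + delta x)^-1.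

Lemma kappa_tildeE x : U x -> kappa_tilde x = kappa_foot x.
Proof.
move=> Ux; have [_ b E] := tau_spec Ux.
by rewrite /kappa_tilde E enorm_foot.
Qed.

(* The stated [kappa_tilde] is [laplacian_delta] with the sign of the distance
   changed; the two agree where [foot_norm] is 1. *)
Lemma laplacian_le_kappa x : U x -> laplacian_delta x <= kappa_foot x.
Proof.
move=> Ux; have [m0 p0 w0] := tau_neq Ux; have w1 := foot_norm_ge1 x.
have /tau_spec[/andP[t0 t1] _ _] := Ux.
rewrite /kappa_foot delta_tau// /laplacian_delta.
move: (tau x) (foot_norm x) m0 p0 w0 w1 t0 t1 => t w m0 p0 w0 w1 t0 t1.
have w2 : 1 <= w ^+ 2 by rewrite exprn_ege1.
have A0 : w ^+ 2 + t != 0 by lra.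
have B0 : w ^+ 2 - t != 0 by lra.
have wp : 0 < w by lra.
have -> : - (w ^+ 3 - t * w)^-1 + (w + t * w)^-1 =
    (- (w ^+ 2 - t)^-1 + (1 + t)^-1) / w.
  by field; rewrite p0 w0 B0 /=; apply/andP; split;
    [rewrite -[X in X + _]mul1r -mulrDl mulf_neq0|
     rewrite exprSr -mulrBl mulf_neq0].
rewrite ler_pM2r ?invr_gt0// -subr_ge0.
(* Pairing the terms in [t] and [- t] gives 2 / (1 - t^2) - 2 w^2 / (w^4 - t^2); the numerator then
   factors, and [w ^+ 2 - 1] is the factor whose sign needs [1 <= w]. *)
have -> : - (w ^+ 2 - t)^-1 + (1 + t)^-1 - ((w ^+ 2 + t)^-1 - (1 - t)^-1) =
   2 * (w ^+ 2 - 1) * (w ^+ 2 + t ^+ 2) /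
   ((w ^+ 2 - t) * (w ^+ 2 + t) * ((1 + t) * (1 - t))).
  by field; rewrite m0 p0 A0 B0.
have t2 := sqr_ge0 t.
apply: divr_ge0; first by apply: mulr_ge0; [apply: mulr_ge0|]; lra.
by apply: mulr_ge0; apply: mulr_ge0; lra.
Qed.

Lemma delta_gt0 x : U x -> 0 < delta x.
Proof.
move=> Ux; rewrite delta_tau//; have /tau_spec[/andP[t0 _] _ _] := Ux.
by rewrite mulr_gt0// (lt_le_trans ltr01 (foot_norm_ge1 x)).
Qed.

(** * Continuity off the axis of the distance, the normal and its derivatives *)

Section Continuity.
Variable x : space3 R.
Hypothesis Ux : U x.

Let m0 : 1 - tau x != 0. Proof. by have [] := tau_neq Ux. Qed.
Let p0 : 1 + tau x != 0. Proof. by have [] := tau_neq Ux. Qed.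
Let w0 : foot_norm x != 0. Proof. by have [] := tau_neq Ux. Qed.
Let ct : tau z @[z --> x] --> tau x. Proof. exact: tau_continuous. Qed.
Let cm : 1 - tau z @[z --> x] --> 1 - tau x.
Proof. by apply: cvgB => //; exact: cvg_cst. Qed.
Let cp : 1 + tau z @[z --> x] --> 1 + tau x.
Proof. by apply: cvgD => //; exact: cvg_cst. Qed.

Lemma foot1_continuous : foot1 z @[z --> x] --> foot1 x.
Proof. by apply: cvgM; [exact: continuous_x1|exact: cvgV]. Qed.

Lemma foot2_continuous : foot2 z @[z --> x] --> foot2 x.
Proof. by apply: cvgM; [exact: continuous_x2|exact: cvgV]. Qed.

Lemma foot3_continuous : foot3 z @[z --> x] --> foot3 x.
Proof. by apply: cvgM; [exact: continuous_x3|exact: cvgV]. Qed.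

Lemma foot_norm_continuous : foot_norm z @[z --> x] --> foot_norm x.
Proof.
apply: (cvg_comp (fun z => 1 + 2 * (foot3 z * foot3 z)) Num.sqrt); last exact: sqrt_continuous.
apply: cvgD; first exact: cvg_cst.
apply: cvgM; first exact: cvg_cst.
by apply: cvgM; exact: foot3_continuous.
Qed.

Lemma delta_continuous : delta z @[z --> x] --> delta x.
Proof.
rewrite [X in _ --> X]delta_tau//.
apply: (@near_eq_cvg_to _ _ _ _ (fun z => tau z * foot_norm z)).
  by near=> z; rewrite delta_tau//; near: z; exact: near_hyp_regular.
by apply: cvgM => //; exact: foot_norm_continuous.
Unshelve. all: by end_near. Qed.

Lemma normal1_continuous : normal1 z @[z --> x] --> normal1 x.
Proof.
by apply: cvgM; [apply: cvgN; exact: foot1_continuous|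
  apply: cvgV => //; exact: foot_norm_continuous].
Qed.

Lemma normal2_continuous : normal2 z @[z --> x] --> normal2 x.
Proof.
by apply: cvgM; [apply: cvgN; exact: foot2_continuous|
  apply: cvgV => //; exact: foot_norm_continuous].
Qed.

Lemma normal3_continuous : normal3 z @[z --> x] --> normal3 x.
Proof.
by apply: cvgM; [exact: foot3_continuous|apply: cvgV => //; exact: foot_norm_continuous].
Qed.

Lemma dtau_continuous v : dtau v z @[z --> x] --> dtau v x.
Proof.
have W0 : foot_norm x ^+ 2 + tau x != 0.
  have /tau_spec[/andP[t0 _] _ _] := Ux; have := foot_norm_ge1 x; nra.
apply: cvgM; last first.
  apply: cvgV => //; apply: cvgD => //.
  by apply: cvgM; exact: foot_norm_continuous.
apply: cvgN; apply: cvgB; apply: cvgM => //.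
  by apply: cvgD; apply: cvgM; do ?[exact: foot1_continuous|exact: foot2_continuous|exact: cvg_cst].
by apply: cvgM; [exact: foot3_continuous|exact: cvg_cst].
Qed.

Lemma dfoot1_continuous v : dfoot1 v z @[z --> x] --> dfoot1 v x.
Proof.
apply: cvgM; last exact: cvgV.
apply: cvgD; first exact: cvg_cst.
by apply: cvgM; [exact: foot1_continuous|exact: dtau_continuous].
Qed.

Lemma dfoot2_continuous v : dfoot2 v z @[z --> x] --> dfoot2 v x.
Proof.
apply: cvgM; last exact: cvgV.
apply: cvgD; first exact: cvg_cst.
by apply: cvgM; [exact: foot2_continuous|exact: dtau_continuous].
Qed.

Lemma dfoot3_continuous v : dfoot3 v z @[z --> x] --> dfoot3 v x.
Proof.
apply: cvgM; last exact: cvgV.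
apply: cvgB; first exact: cvg_cst.
by apply: cvgM; [exact: foot3_continuous|exact: dtau_continuous].
Qed.

Lemma dfoot_norm_continuous v : dfoot_norm v z @[z --> x] --> dfoot_norm v x.
Proof.
apply: cvgM; last by apply: cvgV => //; exact: foot_norm_continuous.
apply: cvgM; last exact: dfoot3_continuous.
by apply: cvgM; [exact: cvg_cst|exact: foot3_continuous].
Qed.

Let cw2 : (foot_norm z ^+ 2)^-1 @[z --> x] --> (foot_norm x ^+ 2)^-1.
Proof.
apply: cvgV; first by rewrite sqrf_eq0.
by apply: cvgM; exact: foot_norm_continuous.
Qed.

Lemma dnormal1_continuous v : dnormal1 v z @[z --> x] --> dnormal1 v x.
Proof.
apply: cvgD.
  by apply: cvgN; apply: cvgM; [exact: dfoot1_continuous|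
    apply: cvgV => //; exact: foot_norm_continuous].
by apply: cvgM => //; apply: cvgM; [exact: foot1_continuous|exact: dfoot_norm_continuous].
Qed.

Lemma dnormal2_continuous v : dnormal2 v z @[z --> x] --> dnormal2 v x.
Proof.
apply: cvgD.
  by apply: cvgN; apply: cvgM; [exact: dfoot2_continuous|
    apply: cvgV => //; exact: foot_norm_continuous].
by apply: cvgM => //; apply: cvgM; [exact: foot2_continuous|exact: dfoot_norm_continuous].
Qed.

Lemma dnormal3_continuous v : dnormal3 v z @[z --> x] --> dnormal3 v x.
Proof.
apply: cvgB.
  by apply: cvgM; [exact: dfoot3_continuous|apply: cvgV => //; exact: foot_norm_continuous].
by apply: cvgM => //; apply: cvgM; [exact: foot3_continuous|exact: dfoot_norm_continuous].
Qed.

Lemma kappa_foot_continuous : kappa_foot z @[z --> x] --> kappa_foot x.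
Proof.
have d0 := delta_gt0 Ux; have w1 := foot_norm_ge1 x.
(* With [w3] this gives d < w <= w^3, so the denominator [foot_norm x ^+ 3 - delta x] is
   positive. *)
have dw : delta x < foot_norm x.
  rewrite delta_tau// gtr_pMl//; first by have /tau_spec[/andP[]] := Ux.
  by rewrite (lt_le_trans ltr01).
have w3 : foot_norm x <= foot_norm x ^+ 3 by rewrite exprS ler_peMr ?exprn_ege1//; lra.
apply: cvgD; [apply: cvgN|]; apply: cvgV; try lra.
  apply: cvgB; last exact: delta_continuous.
  by apply: cvgM; [exact: foot_norm_continuous|apply: cvgM; exact: foot_norm_continuous].
by apply: cvgD; [exact: foot_norm_continuous|exact: delta_continuous].
Qed.

End Continuity.

End NormalDerivatives.

(** * The Hardy inequality *)

Section HardyInequality.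
Context {R : realType}.
Implicit Types (x z v : space3 R).

Notation U := (@hyperboloid R `\` hyp_ridge).

Section Cutoff.
Variables (K : set (space3 R)) (g : space3 R -> R).
Hypotheses (cK : closed K) (g0 : forall x, ~ K x -> g x = 0).

Lemma near_notin x : ~ K x -> \forall z \near x, g z = 0.
Proof.
move=> nKx; apply: (@filterS _ _ _ (~` K)); first by move=> z; exact: g0.
by apply: open_nbhs_nbhs; split => //; exact: closed_openC.
Qed.

(** Off the closed set [K] the function is locally zero. Formulas controlled only on the domain off
    the axis thereby yield continuous functions on the whole space. *)
Lemma continuous_cutoff : (forall x, K x -> g z @[z --> x] --> g x) -> continuous g.
Proof.
move=> cg x; have [Kx|nKx] := pselect (K x); first exact: cg.
rewrite /continuous_at g0//; apply: (@near_eq_cvg_to _ _ _ _ (fun=> 0)).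
  by have := near_notin nKx; apply: filterS => z ->.
exact: cvg_cst.
Qed.

Lemma is_derive_cutoff x v : ~ K x -> is_derive x v g 0.
Proof.
move=> nKx.
have d0 : is_derive x v (cst (0 : R) : space3 R -> R) (0 : R) by exact: is_derive_cst.
apply: near_eq_is_derive d0.
by have := near_notin nKx; apply: filterS => z ->.
Qed.

End Cutoff.

(** Young's inequality for [g] and (c u)^(p-1), c = (p-1)/p, with exponents p and p/(p-1),
    multiplied by [p]. *)
Lemma young_scaled (p u g : R) : 1 < p -> 0 <= u -> 0 <= g ->
  p * ((p - 1) / p) `^ (p - 1) * u `^ (p - 1) * g
    <= g `^ p + (p - 1) * ((p - 1) / p) `^ p * u `^ p.
Proof.
move=> p1 u0 g0; set c := (p - 1) / p.
have p0 : 0 < p by lra.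
have q0 : 0 < p - 1 by lra.
have c0 : 0 <= c by rewrite divr_ge0// ltW.
have pn0 : p != 0 by rewrite gt_eqF.
have qn0 : p - 1 != 0 by rewrite gt_eqF.
have := @conjugate_powR R g ((c * u) `^ (p - 1)) p (p / (p - 1)) g0 (powR_ge0 _ _) p0.
rewrite divr_gt0// => /(_ isT) /(_ ltac:(by field; rewrite pn0 qn0)).
rewrite -powRrM.
have -> : (p - 1) * (p / (p - 1)) = p by field.
rewrite (@powRM _ c u (p - 1) c0 u0) (@powRM _ c u p c0 u0) => h.
have {}h := ler_wpM2l (ltW p0) h.
have e1 : p * (g * (c `^ (p - 1) * u `^ (p - 1))) =
  p * c `^ (p - 1) * u `^ (p - 1) * g by ring.
have e2 : p * (g `^ p / p + c `^ p * u `^ p / (p / (p - 1))) =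
   g `^ p + (p - 1) * c `^ p * u `^ p by field; rewrite pn0 qn0.
by rewrite e1 e2 in h.
Qed.

(** Here [s], [d], [G], [k1], [k2] stand for f, the distance, the normal derivative of f, the
    Laplacian of the distance and [kappa_foot]. The last summand on the left is c^(p-1) times the
    divergence of the field and disappears on integration. *)
Lemma hardy_pointwise (p d s G k1 k2 : R) : 1 < p -> 0 < d -> k1 <= k2 ->
  ((p - 1) / p) `^ p * (`|s| `^ p / d `^ p)
  - ((p - 1) / p) `^ (p - 1) * (k2 * (`|s| `^ p / d `^ (p - 1)))
  + ((p - 1) / p) `^ (p - 1) *
    (p * (s * `|s| `^ (p - 2)) * d `^ (1 - p) * G
     + `|s| `^ p * ((1 - p) * d `^ (1 - p - 1) + d `^ (1 - p) * k1))
  <= `|G| `^ p.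
Proof.
move=> p1 d0 k12; set c := (p - 1) / p.
have p0 : 0 < p by lra.
have q0 : 0 < p - 1 by lra.
have c0 : 0 <= c by rewrite divr_ge0// ltW.
have pn0 : p != 0 by rewrite gt_eqF.
pose u := `|s| / d.
have u0 : 0 <= u by rewrite divr_ge0// ltW.
have uE q : u `^ q = `|s| `^ q / d `^ q.
  by rewrite powRM ?invr_ge0 ?(ltW d0)// -powR_inv1 ?(ltW d0)// -powRrM mulN1r powRN.
have dE1 : d `^ (1 - p) = (d `^ (p - 1))^-1 by rewrite -powRN opprB.
have dE2 : d `^ (1 - p - 1) = (d `^ p)^-1.
  by rewrite -powRN; congr (_ `^ _); ring.
set X := s * `|s| `^ (p - 2) * d `^ (1 - p) * G.
have XE : X <= u `^ (p - 1) * `|G|.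
  apply: (le_trans (ler_norm _)).
  rewrite /X normrM ler_wpM2r// normrM.
  have -> : p - 2 = (p - 1) - 1 by ring.
  have -> : `|d `^ (1 - p)| = (d `^ (p - 1))^-1.
    by rewrite dE1 ger0_norm// invr_ge0 powR_ge0.
  by rewrite norm_mul_powR// -uE.
have cp : c * c `^ (p - 1) = c `^ p by exact: mulr_powRB1.
have pc : p * c = p - 1 by rewrite /c mulrC divfK.
set C := c `^ (p - 1); have C0 : 0 <= C by exact: powR_ge0.
have Y := young_scaled p1 u0 (normr_ge0 G).
rewrite -/c -/C -cp -/C in Y; rewrite -cp -/C.
set m := `|s| `^ p / d `^ (p - 1).
have m0 : 0 <= m by rewrite divr_ge0// powR_ge0.
have ub : u `^ p = `|s| `^ p / d `^ p by exact: uE.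
set b := u `^ p in Y ub.
have h1 : C * (p * X) <= p * C * u `^ (p - 1) * `|G|.
  rewrite [leLHS](_ : _ = p * C * X); last by ring.
  by rewrite -[leRHS]mulrA ler_wpM2l// mulr_ge0// ltW.
have h2 : C * (k1 * m) <= C * (k2 * m) by rewrite ler_wpM2l// ler_wpM2r.
have E : c * C * (`|s| `^ p / d `^ p) - C * (k2 * m) +
    C * (p * (s * `|s| `^ (p - 2)) * d `^ (1 - p) * G +
      `|s| `^ p * ((1 - p) * d `^ (1 - p - 1) + d `^ (1 - p) * k1)) =
  c * C * b - C * (k2 * m) + C * (p * X) + C * (1 - p) * b + C * (k1 * m).
  by rewrite ub /X /m dE2 dE1; ring.
rewrite E.
have F : (p - 1) * (c * C) * b = c * C * b * (p - 1) by ring.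
have F2 : p * c * (C * b) = (p - 1) * (C * b) by rewrite pc.
(* All multiples of |s|^p / d^p cancel, because c + (1 - p) + (p - 1) c = p c - (p - 1) = 0. *)
have F3 : c * C * b + C * (1 - p) * b + (p - 1) * (c * C) * b = 0.
  transitivity (p * c * (C * b) - (p - 1) * (C * b)); first by ring.
  by rewrite F2 subrr.
lra.
Qed.

(** * The flux field of a fixed test function *)

Variables (p : R) (f : space3 R -> R).
Hypotheses (p1 : 1 < p) (tf : test_function U f).

Definition supp : set (space3 R) := closure [set x | f x != 0].

Lemma supp_compact : compact supp. Proof. by case: tf. Qed.
Lemma supp_closed : closed supp. Proof. exact: closed_closure. Qed.
Lemma supp_sub : supp `<=` U. Proof. by case: tf. Qed.

Lemma f_out x : ~ supp x -> f x = 0.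
Proof.
move=> nx; apply/eqP; rewrite -[_ == _]negbK; apply/negP => fx.
by apply: nx; exact: subset_closure.
Qed.

Lemma f_continuous : continuous f. Proof. by case: tf => /(_ 0%N). Qed.

Lemma partial_continuous i : continuous (partial i f).
Proof. by case: tf => /(_ 1%N) [_ /(_ i)[_ ]]. Qed.

Lemma f_is_derive i x : is_derive x (basis_vec i) f (partial i f x).
Proof. by apply: derivableP; case: tf => /(_ 1%N) [_ /(_ i)[+ _]] _ _; apply. Qed.

Lemma partial_out i x : ~ supp x -> partial i f x = 0.
Proof.
move=> nx; have [_ <-] := is_derive_cutoff supp_closed f_out (basis_vec i) nx.
by [].
Qed.

Lemma powf_out x : ~ supp x -> `|f x| `^ p = 0.
Proof. by move=> /f_out ->; rewrite normr0 powR0// gt_eqF// (lt_trans ltr01). Qed.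

Lemma delta_powR_continuous q x : U x ->
  delta z `^ q @[z --> x] --> delta x `^ q.
Proof.
move=> Ux; apply: (cvg_comp delta (fun u => u `^ q) (delta_continuous Ux)).
exact: (is_derive_continuous (is_derive1_powR q (delta_gt0 Ux))).
Qed.

Lemma norm_powR_continuous (g : space3 R -> R) x :
  g z @[z --> x] --> g x -> `|g z| `^ p @[z --> x] --> `|g x| `^ p.
Proof.
move=> cg; apply: (cvg_comp g (fun u => `|u| `^ p) cg).
exact: (is_derive_continuous (is_derive_norm_powR _ p1)).
Qed.

(** The product rule for |f|^p d^(1-p) n along axis [i], where [n] is a component of the normal and
    [dn] its derivative. Each summand has a factor that vanishes with f, so values of [delta] and
    [n] off the support do not matter. *)
Definition dflux (i : 'I_3) (n dn : space3 R -> R) x : R :=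
  p * (f x * `|f x| `^ (p - 2)) * partial i f x * (delta x `^ (1 - p) * n x)
  + `|f x| `^ p * ((1 - p) * delta x `^ (1 - p - 1)
      * dot (normal x) (basis_vec i) * n x + delta x `^ (1 - p) * dn x).

Section Flux.
Variables (i : 'I_3) (n dn : space3 R -> R).
Hypothesis dn_ : forall x, U x -> is_derive x (basis_vec i) n (dn x).
Hypothesis cn : forall x, U x -> n z @[z --> x] --> n x.
Hypothesis cdn : forall x, U x -> dn z @[z --> x] --> dn x.

Lemma flux_is_derive x :
  is_derive x (basis_vec i) (fun z => `|f z| `^ p * (delta z `^ (1 - p) * n z))
    (dflux i n dn x).
Proof.
have [Kx|nKx] := pselect (supp x); last first.
  have -> : dflux i n dn x = 0.
    by rewrite /dflux (powf_out nKx) (f_out nKx) !mul0r mulr0 !mul0r addr0.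
  by apply: (is_derive_cutoff supp_closed) => // z /powf_out ->; rewrite mul0r.
have Ux := supp_sub Kx.
have df := is_derive_comp1 (f_is_derive i x) (is_derive_norm_powR (f x) p1).
have dd := is_derive_comp1 (delta_is_derive (basis_vec i) Ux)
  (is_derive1_powR (1 - p) (delta_gt0 Ux)).
apply: (is_derive_eq (is_derive_mul df (is_derive_mul dd (dn_ Ux)))).
by rewrite /dflux /=; ring.
Qed.

Lemma dflux_out x : ~ supp x -> dflux i n dn x = 0.
Proof.
by move=> nKx; rewrite /dflux (powf_out nKx) (f_out nKx) !mul0r mulr0 !mul0r addr0.
Qed.

Lemma dflux_continuous : continuous (dflux i n dn).
Proof.
apply: (continuous_cutoff supp_closed dflux_out) => x /supp_sub Ux.
have cs : f z * `|f z| `^ (p - 2) @[z --> x] --> f x * `|f x| `^ (p - 2).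
  have q0 : 0 < p - 1 by rewrite subr_gt0.
  have := @continuous_mul_powR R (p - 1) q0 (f x).
  have -> : p - 1 - 1 = p - 2 by ring.
  exact: (cvg_comp f (fun s : R => s * `|s| `^ (p - 2)) (@f_continuous x)).
have cdot : dot (normal z) (basis_vec i) @[z --> x] --> dot (normal x) (basis_vec i).
  apply: cvgD; first apply: cvgD.
  - by apply: cvgM; [exact: normal1_continuous|exact: cvg_cst].
  - by apply: cvgM; [exact: normal2_continuous|exact: cvg_cst].
  - by apply: cvgM; [exact: normal3_continuous|exact: cvg_cst].
apply: cvgD; apply: cvgM.
- apply: cvgM; last exact: partial_continuous.
  by apply: cvgM => //; exact: cvg_cst.
- by apply: cvgM; [exact: delta_powR_continuous|exact: cn].
- by apply: norm_powR_continuous; exact: f_continuous.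
- apply: cvgD; apply: cvgM; last exact: cdn.
  + apply: cvgM => //; apply: cvgM; first exact: cvg_cst.
    exact: delta_powR_continuous.
  + exact: cn.
  + exact: delta_powR_continuous.
Qed.

Lemma integral_dflux : (\int[@lebesgue3 R]_x (dflux i n dn x)%:E = 0)%E.
Proof.
apply: (@integral_partial_eq0 _ i supp
  (fun z => `|f z| `^ p * (delta z `^ (1 - p) * n z))).
- exact: supp_compact.
- by move=> x /powf_out ->; rewrite mul0r.
- exact: dflux_out.
- exact: dflux_continuous.
- exact: flux_is_derive.
Qed.

Lemma integrable_dflux : (@lebesgue3 R).-integrable setT (EFin \o dflux i n dn).
Proof.
exact: (integrable_compact_support supp_compact dflux_continuous dflux_out).
Qed.

End Flux.

Notation i1 := (@Ordinal 3 0 isT).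
Notation i2 := (@Ordinal 3 1 isT).
Notation i3 := (@Ordinal 3 2 isT).

Definition div_flux1 := dflux i1 normal1 (dnormal1 (basis_vec i1)).
Definition div_flux2 := dflux i2 normal2 (dnormal2 (basis_vec i2)).
Definition div_flux3 := dflux i3 normal3 (dnormal3 (basis_vec i3)).

(** Differentiating d^(1-p) produces the squared length of the normal, which is 1; differentiating
    the normal produces its divergence, the Laplacian of the distance. *)
Lemma div_flux x : U x -> div_flux1 x + div_flux2 x + div_flux3 x =
  p * (f x * `|f x| `^ (p - 2)) * delta x `^ (1 - p) * dot (normal x) (gradient f x)
  + `|f x| `^ p * ((1 - p) * delta x `^ (1 - p - 1) + delta x `^ (1 - p) * laplacian_delta x).
Proof.
move=> Ux; rewrite -(divergence_normal Ux).
have u := normal_unit Ux.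
rewrite /div_flux1 /div_flux2 /div_flux3 /dflux.
have e1 : dot (normal x) (basis_vec i1) = normal1 x.
  change (normal1 x * 1 + normal2 x * 0 + normal3 x * 0 = normal1 x).
  by rewrite mulr1 !mulr0 !addr0.
have e2 : dot (normal x) (basis_vec i2) = normal2 x.
  change (normal1 x * 0 + normal2 x * 1 + normal3 x * 0 = normal2 x).
  by rewrite mulr1 !mulr0 !addr0 add0r.
have e3 : dot (normal x) (basis_vec i3) = normal3 x.
  change (normal1 x * 0 + normal2 x * 0 + normal3 x * 1 = normal3 x).
  by rewrite mulr1 !mulr0 !add0r.
rewrite e1 e2 e3 /gradient /dot /=.
have {}u : normal1 x * normal1 x + normal2 x * normal2 x + normal3 x * normal3 x = 1 by exact: u.
change (basis_vec i1) with ((1, 0, 0) : space3 R).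
change (basis_vec i2) with ((0, 1, 0) : space3 R).
change (basis_vec i3) with ((0, 0, 1) : space3 R).
(* The three equal patterns are generalized from right to left, so [b3] is the derivative along the
   first axis and [b1] the one along the third. *)
move: (dnormal1 _ x) (dnormal2 _ x) (dnormal3 _ x) (partial _ f x) (partial _ f x) (partial _ f x).
move=> a1 a2 a3 b1 b2 b3.
transitivity (p * (f x * `|f x| `^ (p - 2)) * delta x `^ (1 - p) *
    (normal1 x * b3 + normal2 x * b2 + normal3 x * b1) +
  `|f x| `^ p * ((1 - p) * delta x `^ (1 - p - 1) *
     (normal1 x * normal1 x + normal2 x * normal2 x + normal3 x * normal3 x)
     + delta x `^ (1 - p) * (a1 + a2 + a3))).
  by ring.
by rewrite u mulr1.
Qed.

(** This and the next two are the integrands of the theorem, with [kappa_foot] and [normal] in place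
    of [kappa_tilde] and the gradient of [delta]: the replacements have known continuity on the
    domain off the axis. *)
Definition weight_term x : R := `|f x| `^ p / delta x `^ p.
Definition curvature_term x : R := kappa_foot x * (`|f x| `^ p / delta x `^ (p - 1)).
Definition gradient_term x : R := `|dot (normal x) (gradient f x)| `^ p.

Lemma weight_term_out x : ~ supp x -> weight_term x = 0.
Proof. by move=> /powf_out; rewrite /weight_term => ->; rewrite mul0r. Qed.

Lemma curvature_term_out x : ~ supp x -> curvature_term x = 0.
Proof. by move=> /powf_out; rewrite /curvature_term => ->; rewrite mul0r mulr0. Qed.

Lemma dot_gradient_out v x : ~ supp x -> dot v (gradient f x) = 0.
Proof. by move=> nx; rewrite /dot /gradient /= !partial_out// !mulr0 !addr0. Qed.

Lemma gradient_term_out x : ~ supp x -> gradient_term x = 0.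
Proof.
move=> nx; rewrite /gradient_term dot_gradient_out// normr0 powR0// gt_eqF//.
exact: lt_trans p1.
Qed.

Lemma powf_div_continuous q x : U x ->
  `|f z| `^ p / delta z `^ q @[z --> x] --> `|f x| `^ p / delta x `^ q.
Proof.
move=> Ux; apply: cvgM; first by apply: norm_powR_continuous; exact: f_continuous.
by apply: cvgV; [rewrite gt_eqF// powR_gt0// delta_gt0|exact: delta_powR_continuous].
Qed.

Lemma integrable_weight_term : (@lebesgue3 R).-integrable setT (EFin \o weight_term).
Proof.
apply: (integrable_compact_support supp_compact _ weight_term_out).
apply: (continuous_cutoff supp_closed weight_term_out) => x /supp_sub Ux.
exact: powf_div_continuous.
Qed.

Lemma integrable_curvature_term : (@lebesgue3 R).-integrable setT (EFin \o curvature_term).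
Proof.
apply: (integrable_compact_support supp_compact _ curvature_term_out).
apply: (continuous_cutoff supp_closed curvature_term_out) => x /supp_sub Ux.
by apply: cvgM; [exact: kappa_foot_continuous|exact: powf_div_continuous].
Qed.

Lemma integrable_gradient_term : (@lebesgue3 R).-integrable setT (EFin \o gradient_term).
Proof.
apply: (integrable_compact_support supp_compact _ gradient_term_out).
apply: (continuous_cutoff supp_closed gradient_term_out) => x /supp_sub Ux.
apply: (@norm_powR_continuous (fun z => dot (normal z) (gradient f z))).
apply: cvgD; first apply: cvgD.
- by apply: cvgM; [exact: normal1_continuous|exact: partial_continuous].
- by apply: cvgM; [exact: normal2_continuous|exact: partial_continuous].
- by apply: cvgM; [exact: normal3_continuous|exact: partial_continuous].
Qed.

Lemma gradient_delta x : U x -> gradient delta x = normal x.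
Proof.
move=> Ux; have e i : partial i delta x = dot (normal x) (basis_vec i).
  by have [_ <-] := delta_is_derive (basis_vec i) Ux.
apply: space3_eq; rewrite /gradient /= e.
- change (normal1 x * 1 + normal2 x * 0 + normal3 x * 0 = normal1 x).
  by rewrite mulr1 !mulr0 !addr0.
- change (normal1 x * 0 + normal2 x * 1 + normal3 x * 0 = normal2 x).
  by rewrite mulr1 !mulr0 !addr0 add0r.
- change (normal1 x * 0 + normal2 x * 0 + normal3 x * 1 = normal3 x).
  by rewrite mulr1 !mulr0 !add0r.
Qed.

(** Since both integrands vanish off the support, which lies in the domain off the axis, agreement
    there suffices to change integrand and region of integration at once. *)
Lemma integral_hyperboloid (g h : space3 R -> R) :
  (forall x, ~ supp x -> g x = 0) -> (forall x, ~ supp x -> h x = 0) ->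
  (forall x, U x -> g x = h x) ->
  (\int[@lebesgue3 R]_(x in hyperboloid) (g x)%:E
   = \int[@lebesgue3 R]_x (h x)%:E)%E.
Proof.
move=> g0 h0 gh; rewrite integral_mkcond; apply: eq_integral => x _.
rewrite patchE; have [Kx|nKx] := pselect (supp x).
  have Ux := supp_sub Kx.
  by rewrite mem_set ?gh//; case: Ux.
by rewrite h0// g0//; case: ifP.
Qed.

Lemma hardy_integral :
  ((((p - 1) / p) `^ p)%R%:E * \int[@lebesgue3 R]_x (weight_term x)%:E
   - (((p - 1) / p) `^ (p - 1))%R%:E * \int[@lebesgue3 R]_x (curvature_term x)%:E
   <= \int[@lebesgue3 R]_x (gradient_term x)%:E)%E.
Proof.
set A := ((p - 1) / p) `^ p; set B := ((p - 1) / p) `^ (p - 1).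
have I1 : (@lebesgue3 R).-integrable setT (EFin \o div_flux1).
  by apply: integrable_dflux; move=> x Ux; [exact: normal1_continuous|exact: dnormal1_continuous].
have I2 : (@lebesgue3 R).-integrable setT (EFin \o div_flux2).
  by apply: integrable_dflux; move=> x Ux; [exact: normal2_continuous|exact: dnormal2_continuous].
have I3 : (@lebesgue3 R).-integrable setT (EFin \o div_flux3).
  by apply: integrable_dflux; move=> x Ux; [exact: normal3_continuous|exact: dnormal3_continuous].
have Z1 : (\int[@lebesgue3 R]_x (div_flux1 x)%:E = 0)%E.
  apply: integral_dflux; move=> x Ux;
    [exact: normal1_is_derive|exact: normal1_continuous|exact: dnormal1_continuous].
have Z2 : (\int[@lebesgue3 R]_x (div_flux2 x)%:E = 0)%E.
  apply: integral_dflux; move=> x Ux;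
    [exact: normal2_is_derive|exact: normal2_continuous|exact: dnormal2_continuous].
have Z3 : (\int[@lebesgue3 R]_x (div_flux3 x)%:E = 0)%E.
  apply: integral_dflux; move=> x Ux;
    [exact: normal3_is_derive|exact: normal3_continuous|exact: dnormal3_continuous].
have mT := @measurableT _ (measurableTypeR R * measurableTypeR R * measurableTypeR R)%type.
have I12 := integrableD mT I1 I2; have I123 := integrableD mT I12 I3.
have JD := integrableZl mT B I123.
have JF := integrableZl mT A integrable_weight_term.
have JG := integrableZl mT B integrable_curvature_term.
have JFG := integrableB mT JF JG; have JJ := integrableD mT JFG JD.
(* The added divergence has integral 0 by [Z1], [Z2], [Z3]; with it the inequality holds pointwise,
   by [hardy_pointwise] on the support and as 0 <= 0 elsewhere. *)
have : (\int[@lebesgue3 R]_x ((A%:E * (weight_term x)%:E - B%:E * (curvature_term x)%:E)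
     + B%:E * ((div_flux1 x)%:E + (div_flux2 x)%:E + (div_flux3 x)%:E)) <=
     \int[@lebesgue3 R]_x (gradient_term x)%:E)%E.
  apply: (le_integral mT JJ integrable_gradient_term) => x _ /=.
  change ((A * weight_term x - B * curvature_term x
    + B * (div_flux1 x + div_flux2 x + div_flux3 x))%:E <= (gradient_term x)%:E)%E.
  rewrite lee_fin.
  have [Kx|nKx] := pselect (supp x); last first.
    rewrite /div_flux1 /div_flux2 /div_flux3 gradient_term_out// weight_term_out//.
    rewrite curvature_term_out// !dflux_out//.
    by rewrite !addr0 !mulr0 subrr addr0.
  have Ux := supp_sub Kx.
  rewrite div_flux//; apply: hardy_pointwise => //; first exact: delta_gt0.
  exact: laplacian_le_kappa.
rewrite (integralD mT JFG JD) (integralB mT JF JG).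
rewrite (integralZl mT I123) (integralZl mT integrable_weight_term).
rewrite (integralZl mT integrable_curvature_term).
rewrite (integralD mT I12 I3) (integralD mT I1 I2).
by rewrite Z1 Z2 Z3 !adde0 mule0 adde0.
Qed.

End HardyInequality.

Theorem corollary5 (R : realType) :
  [/\ (forall x : space3 R, (hyperboloid `\` hyp_ridge) x ->
         exists! y : space3 R, is_near_point hyperboloid x y),
      (ridge_point hyperboloid @` (hyperboloid `\` hyp_ridge) =
         hyp_ridge :> set (space3 R)),
      (forall x : space3 R, (hyperboloid `\` hyp_ridge) x ->
         enorm (near_point hyperboloid x) = delta (ridge_point hyperboloid x))
    & forall (p : R) (f : space3 R -> R), 1 < p ->
        test_function (hyperboloid `\` hyp_ridge) f ->
        ((((p - 1) / p) `^ p)%R%:E *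
            \int[lebesgue3]_(x in hyperboloid)
              (`|f x| `^ p / delta x `^ p)%R%:E
          - (((p - 1) / p) `^ (p - 1))%R%:E *
            \int[lebesgue3]_(x in hyperboloid)
              (kappa_tilde x * (`|f x| `^ p / delta x `^ (p - 1)))%R%:E
        <= \int[lebesgue3]_(x in hyperboloid)
             (`|dot (gradient delta x) (gradient f x)| `^ p)%R%:E)%E].
Proof.
split.
- exact: near_point_unique.
- exact: ridge_point_image.
- exact: delta_ridge_point.
- move=> p f p1 tf.
  have E1 : (\int[lebesgue3]_(x in hyperboloid) (`|f x| `^ p / delta x `^ p)%R%:E =
      \int[lebesgue3]_x (weight_term p f x)%:E)%E.
    by apply: (integral_hyperboloid tf) => // x; exact: weight_term_out.
  have E2 : (\int[lebesgue3]_(x in hyperboloid)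
        (kappa_tilde x * (`|f x| `^ p / delta x `^ (p - 1)))%R%:E =
      \int[lebesgue3]_x (curvature_term p f x)%:E)%E.
    apply: (integral_hyperboloid tf) => x; last by move=> Ux; rewrite kappa_tildeE.
      by move=> /(powf_out p1) ->; rewrite mul0r mulr0.
    exact: curvature_term_out.
  have E3 : (\int[lebesgue3]_(x in hyperboloid)
        (`|dot (gradient delta x) (gradient f x)| `^ p)%R%:E =
      \int[lebesgue3]_x (gradient_term p f x)%:E)%E.
    apply: (integral_hyperboloid tf) => x; last by move=> Ux; rewrite gradient_delta.
      move=> nx; rewrite dot_gradient_out// normr0 powR0// gt_eqF//.
      exact: lt_trans p1.
    exact: gradient_term_out.
  rewrite E1 E2 E3; exact: hardy_integral.
Qed.
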